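(* Let $(X_j,\mathsf d_j,\mathfrak m_j)$, $j\in\mathbb N$, be compact geodesic metric measure spaces whose reference measures $\mathfrak m_j$ are probability measures with full support. Suppose that $(X_j,\mathsf d_j,\mathfrak m_j)$ converges to the metric measure space $(X,\mathsf d,\mathfrak m)$ (with $\mathfrak m$ of full support) in the measured Gromov--Hausdorff topology. If $K_j\to K$ in $\mathbb R$, $\delta_j\ge0$ and $\delta\ge0$ satisfy $\limsup_j\delta_j\le\delta$, and each $X_j$ satisfies $\mathrm{BCD}_{\delta_j}(K_j,\infty)$, then $X$ satisfies $\mathrm{BCD}_\delta(K,\infty)$.
   Context: Measured Gromov--Hausdorff convergence of compact spaces: there are isometric embeddings into a common compact metric space $Z$ such that $X_j\to X$ in Hausdorff distance and $\mathfrak m_j\rightharpoonup\mathfrak m$ weakly. For a complete separable geodesic metric measure space $(X,\mathsf d,\mathfrak m)$ with $\mathfrak m$ locally finite Radon of full support: $\mathcal P_2(X)$ is the set of Borel probability measures with finite second moment with the quadratic Wasserstein distance $W_2$; $\mathrm{Ent}_{\mathfrak m}(\rho\mathfrak m)=\int\rho\log\rho\,d\mathfrak m$ if the positive part is integrable ($0\log0=0$), and $\mathrm{Ent}_{\mathfrak m}(\mu)=+\infty$ otherwise or if $\mu\not\ll\mathfrak m$; $\mathrm D(\mathrm{Ent}_{\mathfrak m})=\{\mu\in\mathcal P_2(X):\mathrm{Ent}_{\mathfrak m}(\mu)\in\mathbb R\}$. For $\Omega=\sum_{i=1}^k\lambda_i\delta_{\mu_i}$ ($\lambda_i>0$, $\sum\lambda_i=1$,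 $\mu_i\in\mathcal P_2(X)$), $\mathrm{Var}(\Omega)=\inf_{\nu\in\mathcal P_2(X)}\sum_i\lambda_iW_2^2(\nu,\mu_i)$ and $\mathrm{Bar}(\Omega)$ is the set of minimizers. For $K\in\mathbb R$, $\delta\ge0$, $\mathrm{BCD}_\delta(K,\infty)$ means: every such $\Omega$ with all $\mu_i\in\mathrm D(\mathrm{Ent}_{\mathfrak m})$ has some $\bar\mu\in\mathrm{Bar}(\Omega)$ with $\mathrm{Ent}_{\mathfrak m}(\bar\mu)\le\sum_i\lambda_i\mathrm{Ent}_{\mathfrak m}(\mu_i)-\frac K2\mathrm{Var}(\Omega)+\delta$. *)

(* Defs.v *)
From HB Require Import structures.
From mathcomp Require Import all_boot all_order all_algebra.
From mathcomp Require Import all_classical all_reals all_analysis.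

Set Implicit Arguments.
Unset Strict Implicit.
Unset Printing Implicit Defensive.

Import Order.TTheory GRing.Theory Num.Theory.
Import numFieldNormedType.Exports.

Local Open Scope classical_set_scope.
Local Open Scope ring_scope.

(* Nonempty metric spaces: the library requires a measurable space to come with
   a point, which plays no other role below. *)
#[short(type="pmetricType")]
HB.structure Definition PointedMetric (R : numDomainType) :=
  {T of Metric R T & isPointed T}.

Notation borel T := (g_sigma_algebraType (@open T)).

Section metric_spaces.
Context {R : realType}.

Definition isometric_embedding (X Z : metricType R) (f : X -> Z) :=
  forall x y, mdist (f x) (f y) = mdist x y.

Definition geodesic_space (X : metricType R) := forall x y : X,
  exists g : R -> X, [/\ g 0 = x, g 1 = y &
    forall s t, 0 <= s <= 1 -> 0 <= t <= 1 ->
      mdist (g s) (g t) = `|s - t| * mdist x y].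

Local Open Scope ereal_scope.

Definition hausdorff_dist (Z : metricType R) (A B : set Z) : \bar R :=
  maxe
    (ereal_sup [set ereal_inf [set (mdist a b)%:E | b in B] | a in A])
    (ereal_sup [set ereal_inf [set (mdist a b)%:E | a in A] | b in B]).

End metric_spaces.

Section measures.
Context {R : realType}.
Local Open Scope ereal_scope.

Definition support (X : ptopologicalType)
    (m : {measure set (borel X) -> \bar R}) : set X :=
  [set x | forall U : set X, open U -> U x -> 0 < m U].

Definition full_support (X : ptopologicalType)
    (m : {measure set (borel X) -> \bar R}) := support m = [set: X].

(* Set functions rather than bundled measures, so that it applies directly to
   the library's [pushforward]. *)
Definition weakly_converges (Z : ptopologicalType)
    (mu_ : nat -> set (borel Z) -> \bar R) (mu : set (borel Z) -> \bar R) :=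
  forall f : Z -> R, continuous f -> bounded_fun f ->
    (fun j => \int[mu_ j]_(z in [set: borel Z]) (f z)%:E) @ \oo -->
      \int[mu]_(z in [set: borel Z]) (f z)%:E.

Definition mGH_converges
    (X_ : nat -> pmetricType R)
    (m_ : forall j, {measure set (borel (X_ j)) -> \bar R})
    (X : pmetricType R) (m : {measure set (borel X) -> \bar R}) :=
  exists (Z : pmetricType R) (i_ : forall j, X_ j -> Z) (i : X -> Z),
    [/\ compact [set: Z],
        (forall j, isometric_embedding (i_ j)) /\ isometric_embedding i,
        (fun j => hausdorff_dist (range (i_ j)) (range i)) @ \oo --> 0 &
        weakly_converges
          (fun j => pushforward (m_ j) (i_ j : borel (X_ j) -> borel Z))
          (pushforward m (i : borel X -> borel Z))].

End measures.

Section bcd.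
Context {R : realType} (X : pmetricType R).
Local Open Scope ereal_scope.

Definition P2 : set (probability (borel X) R) :=
  [set mu : probability (borel X) R |
    exists x0 : X, \int[mu]_x (@mdist R X x0 x ^+ 2)%:E < +oo].

(* On a separable space the product of the Borel sigma-algebras used here is
   the Borel sigma-algebra of the product. The marginals are compared on
   measurable sets only, since library measures are total set functions. *)
Definition couplings (mu nu : probability (borel X) R) :
    set (probability (borel X * borel X)%type R) :=
  [set p : probability (borel X * borel X)%type R |
     forall A : set (borel X), measurable A ->
     p (A `*` setT) = mu A /\ p (setT `*` A) = nu A].

Definition transport_cost (p : probability (borel X * borel X)%type R) :=
  \int[p]_z (@mdist R X z.1 z.2 ^+ 2)%:E.

Definition W2 (mu nu : probability (borel X) R) : \bar R :=
  ereal_inf [set transport_cost p | p in couplings mu nu] `^ (2^-1)%R.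

Definition density (m : {measure set (borel X) -> \bar R})
    (mu : probability (borel X) R) (rho : borel X -> R) :=
  [/\ measurable_fun setT rho, (forall x, 0 <= rho x)%R &
      forall A, measurable A -> mu A = \int[m]_(x in A) (rho x)%:E].

Definition rho_log_rho (rho : borel X -> R) (x : borel X) : \bar R :=
  (rho x * ln (rho x))%:E.

(* The set below has at most one element, as densities are unique almost
   everywhere. It is empty, so that the infimum is +oo, when mu has no density
   or when the positive part of rho log rho is not integrable. *)
Definition Ent (m : {measure set (borel X) -> \bar R})
    (mu : probability (borel X) R) : \bar R :=
  ereal_inf [set \int[m]_x rho_log_rho rho x | rho in
    [set rho | density m mu rho /\ \int[m]_x (rho_log_rho rho)^\+ x < +oo]].

Definition DEnt (m : {measure set (borel X) -> \bar R}) :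
    set (probability (borel X) R) :=
  [set mu | P2 mu /\ Ent m mu \is a fin_num].

(* A finitely supported Omega = \sum_i lambda_i \delta_(mu_i) is given by its
   weights lambda and its atoms mu. *)
Definition bar_cost k (lambda : 'I_k -> R)
    (mu : 'I_k -> probability (borel X) R)
    (nu : probability (borel X) R) : \bar R :=
  \sum_(i < k) (lambda i)%:E * W2 nu (mu i) ^+ 2.

Definition Var k (lambda : 'I_k -> R)
    (mu : 'I_k -> probability (borel X) R) : \bar R :=
  ereal_inf [set bar_cost lambda mu nu | nu in P2].

Definition Bar k (lambda : 'I_k -> R)
    (mu : 'I_k -> probability (borel X) R) : set (probability (borel X) R) :=
  [set nu | P2 nu /\ bar_cost lambda mu nu = Var lambda mu].

Definition BCD (m : {measure set (borel X) -> \bar R}) (delta K : R) :=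
  forall k (lambda : 'I_k -> R) (mu : 'I_k -> probability (borel X) R),
    (forall i, 0 < lambda i)%R -> (\sum_(i < k) lambda i = 1)%R ->
    (forall i, DEnt m (mu i)) ->
    exists2 nu : probability (borel X) R, Bar lambda mu nu &
      Ent m nu <= \sum_(i < k) (lambda i)%:E * Ent m (mu i)
                  - (K / 2)%:E * Var lambda mu + delta%:E.

End bcd.

(* Main.v *)
(* Everything is transported between [X_ j] and [X] by explicit Markov kernels.
   Let [phi] be a partition of unity of scale [e] on the common space [Z], let
   [a l] and [a' l] be the integrals of [phi l] with respect to [m] and [m_ j].
   The kernel [x |-> \sum_l phi l x * (phi l * m_ j) / a' l] from [X] to [X_ j]
   moves mass by at most [2 * e], hence almost preserves integrals of continuous
   functions and transport costs, and increases entropies by at most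
   [ln (max_l a l / a' l)], which is small for large [j] by weak convergence.
   The latter is read off the Donsker-Varadhan form of the entropy,
     Ent_m(nu) <= C  iff  nu(f) <= C + m(exp(f - 1)) for all bounded measurable f,
   which only involves bounded functions and passes to limits.

   Atoms [mu_i] are sent to [X_ j], the condition BCD yields a barycentre there, and
   the barycentre is sent back to [X]. For a sequence of scales tending to 0 the
   resulting measures on [X] have bounded entropy with respect to [m], so their
   setwise limit along an ultrafilter is again countably additive; this replaces
   Prokhorov's theorem. Near optimal couplings are followed through the matrices of
   integrals of [phi l (x) phi l'], whose limit yields a coupling of the limits, so
   that the squared distances are lower semicontinuous; no optimal coupling and no
   gluing of couplings is needed. *)
From HB Require Import structures.
Require Import Defs.
From mathcomp Require Import all_boot all_order all_algebra.
From mathcomp Require Import all_classical all_reals all_analysis.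
From mathcomp Require Import finmap measurable_realfun ring lra.

Set Implicit Arguments.
Unset Strict Implicit.
Unset Printing Implicit Defensive.

Import Order.TTheory GRing.Theory Num.Theory.
Import numFieldNormedType.Exports.

Local Open Scope classical_set_scope.
Local Open Scope ring_scope.

(** * Bounded measurable functions *)

Section bounded_measurable.
Context d (T : measurableType d) (R : realType).
Implicit Types (f g : T -> R) (mu : probability T R).

(** The class of test functions used throughout: every such function is integrable for every
    probability, so integrals are real numbers and linearity comes without integrability
    conditions. *)
Definition bounded_measurable f :=
  measurable_fun [set: T] f /\ exists M : R, forall x, `|f x| <= M.

Lemma bmfun_measurable f : bounded_measurable f -> measurable_fun [set: T] f.
Proof. by case. Qed.

Lemma bmfun_integrable mu f : bounded_measurable f ->
  mu.-integrable [set: T] (EFin \o f).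
Proof.
move=> [mf [M fM]]; apply: measurable_bounded_integrable => //.
  exact: (le_lt_trans (probability_le1 mu measurableT) (ltry 1)).
exists M; split; first exact: num_real.
by move=> N /ltW MN x _ /=; rewrite (le_trans (fM x)).
Qed.

Lemma bmfun_cst r : bounded_measurable (fun=> r).
Proof. by split; [exact: measurable_cst|exists `|r|]. Qed.

Lemma bmfunD f g : bounded_measurable f -> bounded_measurable g ->
  bounded_measurable (fun x => f x + g x).
Proof.
move=> [mf [M fM]] [mg [N gN]]; split; first exact: measurable_funD.
exists (M + N) => x; rewrite (le_trans (ler_normD _ _))//.
exact: lerD.
Qed.

Lemma bmfunM f g : bounded_measurable f -> bounded_measurable g ->
  bounded_measurable (fun x => f x * g x).
Proof.
move=> [mf [M fM]] [mg [N gN]]; split; first exact: measurable_funM.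
by exists (M * N) => x; rewrite normrM ler_pM.
Qed.

Lemma bmfunZ r f : bounded_measurable f -> bounded_measurable (fun x => r * f x).
Proof. exact: bmfunM (bmfun_cst r). Qed.

Lemma bmfunB f g : bounded_measurable f -> bounded_measurable g ->
  bounded_measurable (fun x => f x - g x).
Proof.
move=> bf bg; have := bmfunD bf (bmfunZ (-1) bg).
by under eq_fun do rewrite mulN1r.
Qed.

Lemma bmfun_norm f : bounded_measurable f -> bounded_measurable (fun x => `|f x|).
Proof.
move=> [mf [M fM]]; split; first exact: measurableT_comp.
by exists M => x; rewrite normr_id.
Qed.

Lemma bmfun_sum (I : Type) (r : seq I) (F : I -> T -> R) :
  (forall i, bounded_measurable (F i)) ->
  bounded_measurable (fun x => \sum_(i <- r) F i x).
Proof.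
move=> bF; elim: r => [|i r IH].
  by under eq_fun do rewrite big_nil; exact: bmfun_cst.
by under eq_fun do rewrite big_cons; exact: bmfunD.
Qed.

Lemma bmfun_expR f : bounded_measurable f -> bounded_measurable (fun x => expR (f x)).
Proof.
move=> [mf [M fM]]; split; first exact: measurableT_comp.
exists (expR M) => x; rewrite ger0_norm ?expR_ge0// ler_expR.
by rewrite (le_trans (ler_norm _)).
Qed.

Lemma bmfun_indic (A : set T) : measurable A -> bounded_measurable (\1_A : T -> R).
Proof.
move=> mA; split; first exact: measurable_indic.
by exists 1 => x; rewrite indicE; case: (_ \in _); rewrite ?normr1 ?normr0.
Qed.

Lemma integral_EFin_Rintegral mu f : mu.-integrable [set: T] (EFin \o f) ->
  (\int[mu]_x (f x)%:E = (\int[mu]_x f x)%:E)%E.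
Proof. by move=> intf; rewrite /Rintegral fineK//; exact: integrable_fin_num. Qed.

Lemma Rintegral_cstT mu r : \int[mu]_x r = r.
Proof. by rewrite Rintegral_cst//= probability_setT/= mulr1. Qed.

Lemma bmfun_RintegralD mu f g : bounded_measurable f -> bounded_measurable g ->
  \int[mu]_x (f x + g x) = \int[mu]_x f x + \int[mu]_x g x.
Proof. by move=> bf bg; apply: RintegralD => //; exact: bmfun_integrable. Qed.

Lemma bmfun_RintegralB mu f g : bounded_measurable f -> bounded_measurable g ->
  \int[mu]_x (f x - g x) = \int[mu]_x f x - \int[mu]_x g x.
Proof. by move=> bf bg; apply: RintegralB => //; exact: bmfun_integrable. Qed.

Lemma bmfun_RintegralZl mu r f : bounded_measurable f ->
  \int[mu]_x (r * f x) = r * \int[mu]_x f x.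
Proof. by move=> bf; apply: RintegralZl => //; exact: bmfun_integrable. Qed.

Lemma bmfun_RintegralZr mu r f : bounded_measurable f ->
  \int[mu]_x (f x * r) = \int[mu]_x f x * r.
Proof. by move=> bf; apply: RintegralZr => //; exact: bmfun_integrable. Qed.

Lemma bmfun_Rintegral_sum mu (I : Type) (r : seq I) (F : I -> T -> R) :
  (forall i, bounded_measurable (F i)) ->
  \int[mu]_x (\sum_(i <- r) F i x) = \sum_(i <- r) \int[mu]_x F i x.
Proof.
move=> bF; elim: r => [|i r IH].
  by under eq_Rintegral do rewrite big_nil; rewrite big_nil Rintegral_cstT.
under eq_Rintegral do rewrite big_cons.
by rewrite big_cons bmfun_RintegralD ?IH//; exact: bmfun_sum.
Qed.

Lemma le_bmfun_Rintegral mu f g : bounded_measurable f -> bounded_measurable g ->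
  (forall x, f x <= g x) -> \int[mu]_x f x <= \int[mu]_x g x.
Proof.
by move=> bf bg fg; apply: le_Rintegral => //; exact: bmfun_integrable.
Qed.

Lemma bmfun_Rintegral_dist_le mu f g r :
  bounded_measurable f -> bounded_measurable g ->
  (forall x, `|f x - g x| <= r) -> `|\int[mu]_x f x - \int[mu]_x g x| <= r.
Proof.
move=> bf bg fg; rewrite -bmfun_RintegralB//.
rewrite (le_trans (le_normr_Rintegral _ _))//; first exact/bmfun_integrable/bmfunB.
rewrite -[leRHS](Rintegral_cstT mu); apply: le_bmfun_Rintegral => //.
  exact/bmfun_norm/bmfunB.
exact: bmfun_cst.
Qed.

Lemma Rintegral_indicT mu (A : set T) : measurable A ->
  \int[mu]_x \1_A x = fine (mu A).
Proof. by move=> mA; rewrite /Rintegral integral_indic// setIT. Qed.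

End bounded_measurable.

Lemma bmfun_comp d d' (T : measurableType d) (T' : measurableType d')
    (R : realType) (h : T' -> T) (f : T -> R) :
  measurable_fun [set: T'] h -> bounded_measurable f ->
  bounded_measurable (fun x => f (h x)).
Proof.
move=> mh [mf [M fM]]; split; first exact: measurableT_comp.
by exists M.
Qed.

Lemma Rintegral_pushforward d1 d2 (T1 : measurableType d1)
    (T2 : measurableType d2) (R : realType) (h : T1 -> T2)
    (mu : probability T1 R) (nu : probability T2 R) (f : T2 -> R) :
  measurable_fun [set: T1] h ->
  (forall A, measurable A -> nu A = mu (h @^-1` A)) ->
  bounded_measurable f ->
  \int[nu]_x f x = \int[mu]_x f (h x).
Proof.
move=> mh nuE bf; rewrite /Rintegral; congr fine.
transitivity (\int[pushforward mu h]_x (f x)%:E)%E.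
  by apply: eq_measure_integral => A mA _; exact: nuE.
rewrite integral_pushforward//=.
- by case: bf => mf _; exact/measurable_EFinP.
- exact: (bmfun_integrable mu (bmfun_comp mh bf)).
Qed.

(** * Measures with a density *)

Section density_measure.
Context d (T : measurableType d) (R : realType) (m : probability T R).
Variable rho : T -> R.
Hypotheses (rho_ge0 : forall x, 0 <= rho x)
  (rho_int : m.-integrable [set: T] (EFin \o rho))
  (rho1 : (\int[m]_x (rho x)%:E = 1)%E).

Definition density_measure (A : set T) : \bar R := (\int[m]_(x in A) (rho x)%:E)%E.

Let density_measure0 : density_measure set0 = 0%E.
Proof. by rewrite /density_measure integral_set0. Qed.

Let density_measure_ge0 A : (0 <= density_measure A)%E.
Proof. by apply: integral_ge0 => x _; rewrite lee_fin. Qed.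

Let density_measure_sigma_additive : semi_sigma_additive density_measure.
Proof.
move=> /= A mA tA mUA.
rewrite /density_measure integral_bigcup//=; last first.
  exact: (integrableS _ _ (subsetT _)).
by apply: is_cvg_ereal_nneg_natsum_cond => n _ _; exact: density_measure_ge0.
Qed.

HB.instance Definition _ := isMeasure.Build _ _ _
  density_measure density_measure0 density_measure_ge0
  density_measure_sigma_additive.

Let density_measure_setT : density_measure [set: T] = 1%E.
Proof. exact: rho1. Qed.

HB.instance Definition _ :=
  @Measure_isProbability.Build _ _ R density_measure density_measure_setT.

Lemma exists_density_probability : exists mu : probability T R,
  forall A, mu A = (\int[m]_(x in A) (rho x)%:E)%E.
Proof. by exists density_measure. Qed.

End density_measure.

(** Convertible with [density] on a Borel space, but stated over any measurable space, so that it
    also covers measures on products such as [borel X * borel X]. *)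
Definition is_density d (T : measurableType d) (R : realType)
    (m mu : set T -> \bar R) (rho : T -> R) :=
  [/\ measurable_fun [set: T] rho, forall x, 0 <= rho x &
      forall A, measurable A -> mu A = (\int[m]_(x in A) (rho x)%:E)%E].

Lemma bmfun_is_density d (T : measurableType d) (R : realType)
    (m : probability T R) (rho : T -> R) :
  bounded_measurable rho -> (forall x, 0 <= rho x) -> \int[m]_x rho x = 1 ->
  exists mu : probability T R, is_density m mu rho.
Proof.
move=> brho rho0 rho1.
have irho := bmfun_integrable m brho.
have [|mu muE] := exists_density_probability rho0 irho.
  by rewrite integral_EFin_Rintegral// rho1.
by exists mu; split => //; case: brho.
Qed.

Section density_theory.
Context d (T : measurableType d) (R : realType) (m mu : probability T R).
Variable rho : T -> R.
Hypothesis rhoP : is_density m mu rho.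

Lemma is_density_integrable : m.-integrable [set: T] (EFin \o rho).
Proof.
have [mrho rho0 muE] := rhoP; apply/integrableP; split; first exact/measurable_EFinP.
under eq_integral do rewrite gee0_abs ?lee_fin//.
by rewrite -muE//= probability_setT ltry.
Qed.

Lemma Rintegral_is_density (g : T -> R) : bounded_measurable g ->
  m.-integrable [set: T] (EFin \o (fun x => g x * rho x)) /\
  \int[mu]_x g x = \int[m]_x (g x * rho x).
Proof.
move=> bg; have [mrho rho0 muE] := rhoP; split.
  have [mg [M gM]] := bg.
  apply: (@le_integrable _ _ _ _ _ _ _ (EFin \o (fun x => M * rho x))) => //.
  - by apply/measurable_EFinP; exact: measurable_funM.
  - move=> x _ /=; rewrite lee_fin normrM (ger0_norm (rho0 x)) (le_trans _ (ler_norm _))//.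
    exact: ler_wpM2r.
  - exact: integrableZl is_density_integrable.
have mu_m : mu `<< m.
  apply/null_content_dominatesP => A mA mA0; rewrite muE//.
  by apply: null_set_integral => //; apply/measurable_EFinP/measurable_funTS.
rewrite /Rintegral -(Radon_Nikodym_change_of_variables mu_m)//; last exact: bmfun_integrable.
congr fine; apply: ae_eq_integral => //.
- apply: emeasurable_funM => //; apply/measurable_EFinP; exact: bmfun_measurable.
- by apply/measurable_EFinP; apply: measurable_funM => //; exact: bmfun_measurable.
under [X in ae_eq _ _ _ X]eq_fun do rewrite EFinM.
(* [rho] and the Radon-Nikodym derivative have the same integral over every measurable set, hence
   agree almost everywhere. *)
apply: ae_eqe_mul2l; apply: integral_ae_eq => //.
- exact: Radon_Nikodym_integrable.
- exact/measurable_EFinP.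
- by move=> A _ mA; rewrite -Radon_Nikodym_integral// -muE.
Qed.

End density_theory.

(** * Duality for the entropy *)

(** Young's inequality for the conjugate pair [t ln t], [exp (f - 1)]: it is [1 + u <= exp u] at
    [u = f - 1 - ln t], multiplied by [t]. *)
Lemma mulr_le_xlnx_expR (R : realType) (t f : R) : 0 <= t ->
  f * t <= t * ln t + expR (f - 1).
Proof.
rewrite le_eqVlt => /predU1P[<-|t0]; first by rewrite mulr0 mul0r add0r expR_ge0.
have : 1 + (f - 1 - ln t) <= expR (f - 1 - ln t) by exact: expR_ge1Dx.
rewrite expRB lnK ?posrE// ler_pdivlMr//; nra.
Qed.

Lemma xlnx_geN1 (R : realType) (t : R) : 0 <= t -> - 1 <= t * ln t.
Proof.
move=> t0; have := mulr_le_xlnx_expR 1 t0; rewrite subrr expR0 mul1r; lra.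
Qed.

Definition entropy_dual d (T : measurableType d) (R : realType)
    (m nu : probability T R) (C : R) :=
  forall f : T -> R, bounded_measurable f ->
    \int[nu]_x f x <= C + \int[m]_x expR (f x - 1).

Section entropy_duality.
Context (R : realType) (X : pmetricType R).
Variables (m nu : probability (borel X) R).

Lemma measurable_xlnx (rho : borel X -> R) : measurable_fun [set: borel X] rho ->
  measurable_fun [set: borel X] (fun x => rho x * ln (rho x)).
Proof.
move=> mrho; apply: measurable_funM => //.
by apply: measurableT_comp => //; exact: measurable_ln.
Qed.

(** Since [rho ln rho >= -1], its absolute value is at most its positive part plus 1, and the
    constant 1 is integrable because [m] has mass one. *)
Lemma integrable_rho_log_rho (rho : borel X -> R) : density m nu rho ->
  (\int[m]_x (rho_log_rho rho)^\+ x < +oo)%E ->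
  m.-integrable [set: borel X] (EFin \o (fun x => rho x * ln (rho x))).
Proof.
move=> [mrho rho0 _] posoo.
have mv : measurable_fun [set: borel X] (rho_log_rho rho).
  by apply/measurable_EFinP; exact: measurable_xlnx.
apply/integrableP; split => //.
apply: (@le_lt_trans _ _ (\int[m]_x ((rho_log_rho rho)^\+ x + 1%:E))%E).
  apply: ge0_le_integral => //.
  - exact: measurableT_comp.
  - by apply: emeasurable_funD => //; exact: measurable_funepos.
  - move=> x _; have := xlnx_geN1 (rho0 x).
    rewrite funeposE /rho_log_rho -EFin_max -EFinD lee_fin.
    move: (rho x * ln (rho x)) => r; case: (lerP r 0) => r0 r1.
      by rewrite ler0_norm//; lra.
    by rewrite gtr0_norm//; lra.
rewrite ge0_integralD//; last exact: measurable_funepos.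
by rewrite integral_cst//= probability_setT mule1 lte_add_pinfty// ltry.
Qed.

(** [Ent] is an infimum over densities, so one with integral below [C + e] is picked; integrating
    Young's inequality at [t = rho x] gives the bound up to [e]. *)
Lemma Ent_le_dual (C : R) : (Ent m nu <= C%:E)%E -> entropy_dual m nu C.
Proof.
move=> EC f bf; apply/ler_addgt0Pr => e e0.
have /ereal_inf_lt[_ [rho [drho pos] <-]] : (Ent m nu < (C + e)%:E)%E.
  by rewrite (le_lt_trans EC)// lte_fin ltrDl.
have iu := integrable_rho_log_rho drho pos.
rewrite integral_EFin_Rintegral// lte_fin => ltC.
have [ifr ->] := Rintegral_is_density drho bf.
have be : bounded_measurable (fun x => expR (f x - 1)).
  by apply: bmfun_expR; apply: bmfunB => //; exact: bmfun_cst.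
apply: (@le_trans _ _ (\int[m]_x (rho x * ln (rho x) + expR (f x - 1)))).
  apply: le_Rintegral => //.
  - rewrite [X in integrable _ _ X](_ : _ = ((EFin \o (fun x => rho x * ln (rho x))%R)
      \+ (EFin \o (fun x => expR (f x - 1)%R)))%E)//.
    by apply: integrableD => //; exact: bmfun_integrable.
  - by move=> x _; apply: mulr_le_xlnx_expR; case: drho.
rewrite RintegralD//; last exact: bmfun_integrable.
by rewrite addrAC lerD2r ltW.
Qed.

End entropy_duality.

Section clamp.
Variable R : realType.
Implicit Types (t : R) (n : nat).

(** The truncation levels are exponentials so that [ln (clamp n t)] lies in [[- n, n]], also when
    [t = 0]. *)
Definition clamp n t := Num.max (expR (- n%:R)) (Num.min t (expR n%:R)).

Lemma clamp_gt0 n t : 0 < clamp n t.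
Proof. by rewrite lt_max expR_gt0. Qed.

Lemma clamp_ge n t : expR (- n%:R) <= clamp n t.
Proof. by rewrite le_max lexx. Qed.

Lemma clamp_le n t : clamp n t <= expR n%:R.
Proof.
rewrite ge_max ge_min lexx orbT andbT ler_expR.
by rewrite (le_trans (_ : _ <= 0))// oppr_le0.
Qed.

(** With [c = clamp n t], the quantity [t (1 + ln c) - c] is what the dual bound integrates for the
    test function [1 + ln c]; a lower bound uniform in [n] is what Fatou's lemma requires.
    Untruncated values give [t ln t], values above [exp n] give something nonnegative, and values
    below [exp (- n)] are controlled by [exp (- n) (1 + n) <= 1]. *)
Lemma clamp_xlnx_geN1 n t : 0 <= t ->
  - 1 <= t * (1 + ln (clamp n t)) - clamp n t.
Proof.
move=> t0; have n0 : (0 : R) <= n%:R by [].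
have e1 := expR_ge1Dx (n%:R : R).
have e2 : expR (- n%:R) * (1 + n%:R) <= 1 :> R.
  by rewrite expRN ler_pdivrMl ?expR_gt0// mulr1.
have e0 : 0 < expR (- n%:R) :> R by exact: expR_gt0.
rewrite /clamp; case: (leP t (expR n%:R)) => tn.
  case: (leP (expR (- n%:R)) t) => tn'.
    by have := xlnx_geN1 t0; lra.
  by rewrite expRK; nra.
have e12 : expR (- n%:R) <= expR n%:R :> R by rewrite ler_expR; lra.
by rewrite max_r// expRK; nra.
Qed.

(** For [t > 0] the sequence is constant once [n] exceeds the absolute value of [ln t]; at [t = 0]
    it is [- exp (- n)]. *)
Lemma cvg_clamp_xlnx t : 0 <= t ->
  t * (1 + ln (clamp n t)) - clamp n t @[n --> \oo] --> t * ln t.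
Proof.
rewrite le_eqVlt => /predU1P[<-|t0].
  rewrite mul0r [X in X @ _](_ : _ = (fun n => - 1 * expR (- 1) ^+ n)); last first.
    apply/funext => n; rewrite mul0r sub0r mulN1r -expRM_natr mulN1r /clamp.
    by rewrite min_l ?expR_ge0// max_l// expR_ge0.
  rewrite -[X in _ --> X](mulr0 (-1)); apply: cvgMr; apply: cvg_expr.
  by rewrite ger0_norm ?expR_ge0// -[ltRHS]expR0 ltr_expR ltrN10.
apply/cvg_ballP => e e0; near=> n.
rewrite (_ : t * (1 + ln (clamp n t)) - clamp n t = t * ln t); first exact: ballxx.
have nt : `|ln t| <= n%:R.
  by near: n; exact: nbhs_infty_ger.
have [l1 l2] : - n%:R <= ln t /\ ln t <= n%:R by move: nt; rewrite ler_norml => /andP[].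
have -> : clamp n t = t.
  rewrite /clamp -[X in Num.min X _](@lnK _ t)// min_l ?ler_expR// max_r ?ler_expR//.
  exact: lnK.
ring.
Unshelve. all: by end_near. Qed.

End clamp.

(** Test with [s] times the indicator of [A], whose exponential is at most 1 off [A] and [exp s] on
    it. As [s] is free, this is absolute continuity with respect to [m], uniform over all [nu]
    sharing the bound [C]. *)
Lemma entropy_dual_measure_le d (T : measurableType d) (R : realType)
    (m nu : probability T R) (C s : R) (A : set T) :
  entropy_dual m nu C -> measurable A -> 
  s * fine (nu A) <= C + 1 + expR s * fine (m A).
Proof.
move=> H mA; have bA := bmfun_indic R mA.
have := H (fun x => s * \1_A x) (bmfunZ s bA).
rewrite bmfun_RintegralZl// Rintegral_indicT// => /le_trans; apply.
rewrite -addrA lerD2l -(Rintegral_indicT m mA) -bmfun_RintegralZl//.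
rewrite -[X in _ <= X + _](Rintegral_cstT m) -bmfun_RintegralD//; last 2 first.
  exact: bmfun_cst.
  exact: bmfunZ.
apply: le_bmfun_Rintegral => //.
- by apply/bmfun_expR/bmfunB; [exact: bmfunZ|exact: bmfun_cst].
- by apply: bmfunD; [exact: bmfun_cst|exact: bmfunZ].
- move=> x; rewrite indicE; case: (x \in A) => /=.
    by rewrite !mulr1 ler_wpDl// ler_expR gerBl.
  by rewrite !mulr0 addr0 sub0r -[leRHS]expR0 ler_expR oppr_le0.
Qed.

Lemma entropy_dual_dominates d (T : measurableType d) (R : realType)
    (m nu : probability T R) (C : R) :
  entropy_dual m nu C -> nu `<< m.
Proof.
move=> H; apply/null_content_dominatesP => A mA mA0.
have bound s := entropy_dual_measure_le s H mA.
apply/eqP; rewrite -[X in X == _]fineK ?fin_num_measure//.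
rewrite eqe; apply/eqP; apply: contrapT => /eqP nuA.
have nuA0 : 0 < fine (nu A) by rewrite lt_neqAle eq_sym nuA fine_ge0.
(* When [m A = 0] the right-hand side no longer depends on [s]; this [s] makes the left-hand side
   exceed [C + 1]. *)
have := bound ((`|C| + 2) / fine (nu A)).
rewrite mulfVK// mA0/= mulr0 addr0; have := ler_norm C; lra.
Qed.

Lemma limn_einf_le (R : realType) (u : (\bar R)^nat) (M : \bar R) :
  (forall n, u n <= M)%E -> (limn_einf u <= M)%E.
Proof.
move=> uM; rewrite limn_einf_lim; apply: lime_le; first exact: is_cvg_einfs.
near=> n; rewrite (le_trans _ (uM n))//.
by apply: ereal_inf_lbound; exists n => /=.
Unshelve. all: by end_near. Qed.

Section entropy_duality_converse.
Context (R : realType) (X : pmetricType R).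
Variables (m nu : probability (borel X) R).

Lemma bmfun_clamp n (rho : borel X -> R) : measurable_fun [set: borel X] rho ->
  bounded_measurable (fun x => clamp n (rho x)).
Proof.
move=> mrho; split.
  by apply: measurable_maxr => //; exact: measurable_minr.
by exists (expR n%:R) => x; rewrite gtr0_norm ?clamp_gt0// clamp_le.
Qed.

Lemma bmfun_ln_clamp n (rho : borel X -> R) : measurable_fun [set: borel X] rho ->
  bounded_measurable (fun x => 1 + ln (clamp n (rho x))).
Proof.
move=> mrho; apply: bmfunD; first exact: bmfun_cst.
split.
  apply: measurableT_comp; first exact: measurable_ln.
  by case: (bmfun_clamp n mrho).
exists n%:R => x; rewrite ler_norml -{1}(expRK (- n%:R)) -{2}(expRK n%:R).
by rewrite !ler_ln ?posrE ?clamp_gt0 ?expR_gt0// clamp_ge clamp_le.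
Qed.

(* The supremum over [f] is attained at [1 + ln rho], which is approximated by the
   bounded functions [1 + ln (clamp n rho)]; Fatou's lemma concludes. *)
Lemma dual_Ent_le (C : R) : entropy_dual m nu C -> (Ent m nu <= C%:E)%E.
Proof.
move=> H; have nu_m := entropy_dual_dominates H.
have [f [f0 ffin fint fE]] := radon_nikodym_sigma_finite nu_m.
pose rho x := fine (f x).
have rhoE x : (rho x)%:E = f x by rewrite /rho fineK.
have mrho : measurable_fun [set: borel X] rho.
  apply/measurable_EFinP; rewrite [X in measurable_fun _ X](_ : _ = f).
    by case/integrableP : fint.
  by apply/funext => x; rewrite /= rhoE.
have rho0 x : 0 <= rho x by exact: fine_ge0.
have drho : density m nu rho.
  split => // A mA; rewrite fE//.
  by apply: eq_integral => x _; rewrite rhoE.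
(* For [f = 1 + ln (clamp n rho)] one has [exp (f - 1) = clamp n rho], so the dual bound says that
   [h n] has integral at most [C + 1]; the added 1 makes [h n] nonnegative for Fatou's lemma. *)
pose h n x := rho x * (1 + ln (clamp n (rho x))) - clamp n (rho x) + 1.
have ih n : m.-integrable [set: borel X] (EFin \o h n) /\ \int[m]_x h n x <= C + 1.
  have bl := bmfun_ln_clamp n mrho.
  have bc := bmfun_clamp n mrho.
  have [i1 e1] := Rintegral_is_density drho bl.
  have i2 : m.-integrable [set: borel X]
      (EFin \o (fun x => (1 + ln (clamp n (rho x))) * rho x - clamp n (rho x))%R).
    rewrite [X in integrable _ _ X](_ : _ =
      (EFin \o (fun x => (1 + ln (clamp n (rho x))) * rho x)%R) \-
      (EFin \o (fun x => clamp n (rho x))))%E//.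
    by apply: integrableB => //; exact: bmfun_integrable.
  have hE : h n = fun x => (1 + ln (clamp n (rho x))) * rho x - clamp n (rho x) + 1.
    by apply/funext => x; rewrite /h [rho x * _]mulrC.
  rewrite hE; split.
    rewrite [X in integrable _ _ X](_ : _ =
      (EFin \o (fun x => (1 + ln (clamp n (rho x))) * rho x - clamp n (rho x))%R)
      \+ (EFin \o (fun=> 1%R)))%E//.
    by apply: integrableD => //; apply: bmfun_integrable; exact: bmfun_cst.
  rewrite RintegralD//; last by apply: bmfun_integrable; exact: bmfun_cst.
  rewrite RintegralB//; last exact: bmfun_integrable.
  rewrite Rintegral_cstT lerD2r lerBlDr -e1 (le_trans (H _ bl))// lerD2l.
  rewrite le_eqVlt; apply/orP; left; apply/eqP; apply: eq_Rintegral => x _.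
  by rewrite addrC addKr lnK// posrE clamp_gt0.
have h0 n x : 0 <= h n x.
  by rewrite /h -lerBlDr sub0r; exact: clamp_xlnx_geN1.
have mh n : measurable_fun [set: borel X] (EFin \o h n).
  by have [/integrableP[]] := ih n.
have int_le : (\int[m]_x (rho x * ln (rho x) + 1)%:E <= (C + 1)%:E)%E.
  rewrite (eq_integral (fun x => limn_einf (fun n => (h n x)%:E))); last first.
    move=> x _; apply/esym.
    have hx : (h n x)%:E @[n --> \oo] --> (rho x * ln (rho x) + 1)%:E.
      apply/cvg_EFin; first by near=> n.
      apply: cvgD; last exact: cvg_cst.
      exact: cvg_clamp_xlnx.
    by rewrite is_cvg_limn_einfE; [exact: cvg_lim|apply: cvgP hx].
  apply: le_trans (fatou _ _ _ _) _ => //.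
    by move=> n x _; rewrite lee_fin.
  apply: limn_einf_le => n; have [i1 i2] := ih n.
  by rewrite integral_EFin_Rintegral// lee_fin.
apply: ge_ereal_inf.
have mu1 : measurable_fun [set: borel X] (fun x => rho x * ln (rho x) + 1).
  by apply: measurable_funD => //; exact: measurable_xlnx.
have u1 x : 0 <= rho x * ln (rho x) + 1 by rewrite -lerBlDr sub0r xlnx_geN1.
have pos : (\int[m]_x (rho_log_rho rho)^\+ x < +oo)%E.
  apply: le_lt_trans (le_trans _ int_le) (ltry _).
  apply: ge0_le_integral => //.
  - apply: measurable_funepos; apply/measurable_EFinP; exact: measurable_xlnx.
  - exact/measurable_EFinP.
  - move=> x _; rewrite funeposE /rho_log_rho -EFin_max lee_fin ge_max u1 andbT.
    by rewrite lerDl.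
exists (\int[m]_x rho_log_rho rho x)%E; first by exists rho.
have iu := integrable_rho_log_rho drho pos.
rewrite integral_EFin_Rintegral// lee_fin -(lerD2r 1).
rewrite -{1}(Rintegral_cstT m 1) -RintegralD//; last first.
  by apply: bmfun_integrable; exact: bmfun_cst.
rewrite -lee_fin -integral_EFin_Rintegral//.
rewrite [X in integrable _ _ X](_ : _ =
  (EFin \o (fun x => rho x * ln (rho x))%R) \+ (EFin \o (fun=> 1%R)))%E//.
by apply: integrableD => //; apply: bmfun_integrable; exact: bmfun_cst.
Unshelve. all: by end_near. Qed.

End entropy_duality_converse.

(** * Compact metric spaces *)

Lemma cvgr_sum (R : realType) (T I : Type) (F : set_system T) (r : seq I)
    (f : I -> T -> R) (a : I -> R) : Filter F ->
  (forall i, f i x @[x --> F] --> a i) ->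
  \sum_(i <- r) f i x @[x --> F] --> \sum_(i <- r) a i.
Proof. by move=> FF fa; apply: cvg_big => //; exact: add_continuous. Qed.

Lemma cvgr_maxr (R : realType) (T : Type) (F : set_system T) (f : T -> R)
    (a c : R) : Filter F ->
  f x @[x --> F] --> a -> Num.max c (f x) @[x --> F] --> Num.max c a.
Proof.
move=> FF /cvgrPdist_le fa; apply/cvgrPdist_le => e e0.
near=> x; have : `|a - f x| <= e by near: x; exact: fa.
rewrite !ler_norml; case: (leP c a); case: (leP c (f x)); lra.
Unshelve. all: by end_near. Qed.

Lemma open_measurable_borel (X : ptopologicalType) (U : set X) :
  open U -> measurable (U : set (borel X)).
Proof. by move=> oU; exact: sub_sigma_algebra. Qed.

Lemma continuous_measurable_borel (X Y : ptopologicalType) (h : X -> Y) :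
  continuous h -> measurable_fun [set: borel X] (h : borel X -> borel Y).
Proof.
move=> /continuousP ch; apply: (@measurability _ _ (borel X) (borel Y) setT h (@open Y)) => //.
move=> _ [U oU <-].
by rewrite setTI; apply: open_measurable_borel; exact: ch.
Qed.

Lemma continuous_measurable_realfun (R : realType) (X : ptopologicalType)
    (h : X -> R) : continuous h -> measurable_fun [set: borel X] (h : borel X -> R).
Proof.
move=> /continuousP ch; apply: (measurability _ (RGenOpens.measurableE R)).
move=> _ [_ [a [b ->] <-]]; rewrite setTI.
by apply: open_measurable_borel; apply: ch; exact: interval_open.
Qed.

Section metric.
Context (R : realType).
Implicit Types X Z : pmetricType R.

Lemma isometric_continuous X Z (i : X -> Z) :
  isometric_embedding i -> continuous i.
Proof.
move=> iso x; apply/metricType_numDomainType.cvgrPdist_lt => e e0.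
near=> y; rewrite iso; near: y.
by apply/metricType_numDomainType.nbhs_mdistP; exists e.
Unshelve. all: by end_near. Qed.

Lemma mdist_dist_le Z (x y z w : Z) :
  `|mdist x y - mdist z w| <= mdist x z + mdist y w.
Proof.
have h1 := metric_triangle x z y; have h2 := metric_triangle z w y.
have h3 := metric_triangle z x w; have h4 := metric_triangle x y w.
rewrite (metric_sym w y) in h2; rewrite (metric_sym z x) in h3.
by rewrite ler_norml; lra.
Qed.

Lemma mdist_continuous Z (c : Z) : continuous (fun z => mdist c z).
Proof.
move=> z; apply/cvgrPdist_le => e e0; near=> y.
rewrite (le_trans (mdist_dist_le _ _ _ _))// mdistxx add0r ltW//; near: y.
by apply/metricType_numDomainType.nbhs_mdistP; exists e.
Unshelve. all: by end_near. Qed.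

Lemma mdist_open_ball Z (c : Z) (r : R) : open [set z | mdist c z < r].
Proof.
rewrite [X in open X](_ : _ = (fun z => mdist c z) @^-1` [set t | t < r])//.
by apply: open_comp; [move=> z _; exact: mdist_continuous|exact: open_lt].
Qed.

Lemma compact_mdist_bounded Z : compact [set: Z] ->
  exists2 D : R, 0 < D & forall x y : Z, mdist x y <= D.
Proof.
rewrite compact_cover => cZ.
have [|z _|F FT cov] := cZ _ [set: Z] (fun c => [set z | mdist c z < 1]).
- by move=> c _; exact: mdist_open_ball.
- by exists z => //=; rewrite mdistxx.
(* The sum over all pairs of centres dominates each single distance between centres; 2 accounts for
   the two unit radii. *)
pose D := \sum_(a <- F) \sum_(b <- F) mdist a b + 2.
have D0 : 0 <= \sum_(a <- F) \sum_(b <- F) mdist a b.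
  by apply: sumr_ge0 => a _; apply: sumr_ge0 => b _; exact: mdist_ge0.
exists D => [|x y]; first by rewrite ltr_wpDl.
have [a /= aF ax] := cov x I; have [b /= bF byy] := cov y I.
have h := mdist_dist_le x y a b.
rewrite (metric_sym x a) (metric_sym y b) in h.
have h' : mdist a b <= \sum_(a <- F) \sum_(b <- F) mdist a b.
  rewrite (big_rem a)//= (big_rem b)//= -addrA lerDl addr_ge0//.
    by apply: sumr_ge0 => ? _; exact: mdist_ge0.
  by apply: sumr_ge0 => ? _; apply: sumr_ge0 => ? _; exact: mdist_ge0.
move: h; rewrite ler_norml /D => /andP[_]; lra.
Qed.

(** Heine-Cantor through near coverings, the parameter being the radius [r] tending to 0 from the
    right. Locally the radius is halved, so that a point close to a point close to [x] stays in the
    ball around [x]. *)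
Lemma compact_unif_continuous Z (f : Z -> R) (e : R) : compact [set: Z] ->
  continuous f -> 0 < e ->
  exists2 r : R, 0 < r & forall x y, mdist x y < r -> `|f x - f y| <= e.
Proof.
move=> /compact_near_coveringP cZ cf e0.
have [|r /= r0 H] := cZ R (0^'+) (fun r x => forall y, mdist x y < r -> `|f x - f y| <= e).
  move=> x _.
  have /metricType_numDomainType.nbhs_mdistP[r /= r0 fr] : \forall y \near x, `|f x - f y| < e / 2.
    by apply: cvgr_dist_lt; [exact: cf|rewrite divr_gt0].
  exists ([set y | mdist x y < r / 2], [set s | 0 < s < r / 2]) => /=.
    split.
      by apply/metricType_numDomainType.nbhs_mdistP; exists (r / 2) => //=; rewrite divr_gt0.
    exists (r / 2); first by rewrite /= divr_gt0.
    by move=> s /=; rewrite sub0r normrN => + s0; rewrite gtr0_norm// s0.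
  move=> [y s] /= [xy /andP[s0 sr]] z yz.
  have h1 := fr y; have h2 := fr z; rewrite /= in h1 h2.
  have xz := metric_triangle x y z.
  rewrite (_ : f y - f z = (f x - f z) - (f x - f y)); last by ring.
  rewrite (le_trans (ler_normB _ _))//.
  have a1 : `|f x - f y| < e / 2 by apply: h1; lra.
  have a2 : `|f x - f z| < e / 2 by apply: h2; lra.
  by lra.
exists (r / 2); first by rewrite divr_gt0.
move=> x y xy; apply: (H (r / 2)) => //=.
  rewrite sub0r normrN gtr0_norm ?divr_gt0//; lra.
by rewrite divr_gt0.
Qed.

(* The points of [A] are at distance less than [e / 4] of a centre, which makes
   the denominators below bounded away from zero near [A]. *)
Lemma partition_of_unity Z (A : set Z) (e : R) : compact A -> 0 < e ->
  exists (I : finType) (c : I -> Z) (phi : I -> Z -> R),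
    [/\ forall l, continuous (phi l), forall l z, 0 <= phi l z <= 1,
        forall l z, 0 < phi l z -> mdist (c l) z < e,
        forall l, A (c l) /\ 0 < phi l (c l) &
        forall a z, A a -> mdist a z < e / 4 -> \sum_(l : I) phi l z = 1].
Proof.
move=> cA e0; have e4 : 0 < e / 4 by rewrite divr_gt0.
move: (cA); rewrite compact_cover.
move=> /(_ _ A (fun c => [set z | mdist c z < e / 4]))[||F FA cov].
- by move=> c _; exact: mdist_open_ball.
- by move=> z Az; exists z => //=; rewrite mdistxx.
pose psi (l : F) z := Num.max 0 (e - mdist (val l) z).
pose S z := \sum_(l : F) psi l z.
(* The maximum keeps the denominator positive on all of [Z]. Within [e / 4] of [A] some centre is
   closer than [e / 2], so [S >= e / 2] there and the quotients sum to exactly 1. *)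
pose m z := Num.max (e / 2) (S z).
have psi0 l z : 0 <= psi l z by rewrite le_max lexx.
have m0 z : 0 < m z by rewrite lt_max divr_gt0.
have psi_cont l : continuous (psi l).
  move=> z; by apply: cvgr_maxr; apply: cvgB; [exact: cvg_cst|exact: mdist_continuous].
have S_cont : continuous S.
  by move=> z; apply: cvgr_sum => l; exact: psi_cont.
have m_cont : continuous m.
  by move=> z; apply: cvgr_maxr; exact: S_cont.
exists F, val, (fun l z => psi l z / m z); split.
- by move=> l z; apply: cvgM; [exact: psi_cont|apply: cvgV => //; rewrite ?gt_eqF//; exact: m_cont].
- move=> l z; rewrite divr_ge0 ?(ltW (m0 _))//= ler_pdivrMr// mul1r le_max.
  by apply/orP; right; rewrite /S (bigD1 l)//= lerDl sumr_ge0.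
- move=> l z; rewrite pmulr_lgt0 ?invr_gt0// lt_max ltxx/= subr_gt0.
  by [].
- move=> l; split; first by apply/set_mem/FA/valP.
  by rewrite divr_gt0// lt_max mdistxx subr0 e0 orbT.
move=> a z Aa az; rewrite -mulr_suml.
have [c /= cF ca] := cov a Aa.
rewrite -/(S z).
have Sz : e / 2 <= S z.
  rewrite /S (bigD1 [` cF]%fset)//= ler_wpDr ?sumr_ge0// le_max; apply/orP; right.
  by have := metric_triangle c a z; rewrite /=; lra.
by rewrite /m max_r// divff// gt_eqF// (lt_le_trans _ Sz)// divr_gt0.
Qed.

End metric.

Lemma convex_sum_dist_le (R : realType) (J : finType) (w a : J -> R) (b k : R) :
  (forall j, 0 <= w j) -> \sum_j w j = 1 ->
  (forall j, 0 < w j -> `|a j - b| <= k) -> `|\sum_j w j * a j - b| <= k.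
Proof.
move=> w0 w1 ab.
rewrite -[b]mul1r -w1 mulr_suml -sumrB (le_trans (ler_norm_sum _ _ _))//.
rewrite -[leRHS]mul1r -w1 mulr_suml; apply: ler_sum => j _.
rewrite -mulrBr normrM (ger0_norm (w0 j)).
have := w0 j; rewrite le_eqVlt => /predU1P[<-|wj]; first by rewrite !mul0r.
by rewrite ler_pM2l// ab.
Qed.

Section product_weights.
Context (R : realType) (I : finType) (T1 T2 : Type).
Variables (psi1 : I -> T1 -> R) (psi2 : I -> T2 -> R).

Definition prod_weight (p : I * I) (z : T1 * T2) := psi1 p.1 z.1 * psi2 p.2 z.2.

Lemma prod_weight_ge0 : (forall l x, 0 <= psi1 l x) -> (forall l x, 0 <= psi2 l x) ->
  forall p z, 0 <= prod_weight p z.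
Proof. by move=> h1 h2 p z; rewrite mulr_ge0. Qed.

Lemma prod_weight_gt0 : (forall l x, 0 <= psi1 l x) -> (forall l x, 0 <= psi2 l x) ->
  forall p z, 0 < prod_weight p z -> 0 < psi1 p.1 z.1 /\ 0 < psi2 p.2 z.2.
Proof.
move=> h1 h2 p z; rewrite /prod_weight.
have := h1 p.1 z.1; rewrite le_eqVlt => /predU1P[<-|p1]; first by rewrite mul0r ltxx.
by rewrite pmulr_rgt0.
Qed.

Lemma prod_weight_sum : (forall x, \sum_l psi1 l x = 1) ->
  (forall x, \sum_l psi2 l x = 1) -> forall z, \sum_p prod_weight p z = 1.
Proof.
move=> h1 h2 z; rewrite -[RHS]mulr1 -{1}(h1 z.1) -(h2 z.2) mulr_suml.
under [RHS]eq_bigr do rewrite mulr_sumr.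
by rewrite (pair_bigA _ (fun l l' => psi1 l z.1 * psi2 l' z.2)).
Qed.

End product_weights.

Lemma bmfun_prod_weight (R : realType) (I : finType) d1 d2 (T1 : measurableType d1)
    (T2 : measurableType d2) (psi1 : I -> T1 -> R) (psi2 : I -> T2 -> R) p :
  (forall l, bounded_measurable (psi1 l)) -> (forall l, bounded_measurable (psi2 l)) ->
  bounded_measurable (prod_weight psi1 psi2 p).
Proof.
move=> b1 b2; apply: (@bmfunM _ _ _ (fun z => psi1 p.1 z.1) (fun z => psi2 p.2 z.2)).
  exact: (bmfun_comp measurable_fst (b1 p.1)).
exact: (bmfun_comp measurable_snd (b2 p.2)).
Qed.

Lemma bmfun_continuous (R : realType) (X : pmetricType R) (f : X -> R) :
  continuous f -> (forall x, 0 <= f x <= 1) ->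
  bounded_measurable (f : borel X -> R).
Proof.
move=> cf f01; split; first exact: continuous_measurable_realfun.
by exists 1 => x; have /andP[f0 f1] := f01 x; rewrite ger0_norm.
Qed.

Lemma measurable_mdist (R : realType) (X : pmetricType R) : compact [set: X] ->
  measurable_fun [set: borel X * borel X] (fun z => @mdist R X z.1 z.2).
Proof.
move=> cX.
have /choice[h hP] n : exists h : borel X * borel X -> R,
    measurable_fun [set: borel X * borel X] h /\
    forall z, `|h z - @mdist R X z.1 z.2| <= 2 * n.+1%:R^-1.
  have n0 : 0 < n.+1%:R^-1 :> R by rewrite invr_gt0.
  have [I [c [phi [phic phi01 phid _ phi1]]]] := partition_of_unity cX n0.
  have phi0 l x : 0 <= phi l x by have /andP[] := phi01 l x.
  exists (fun z => \sum_p prod_weight phi phi p z * mdist (c p.1) (c p.2)); split.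
    apply: bmfun_measurable; apply: bmfun_sum => p; apply: bmfunM; last exact: bmfun_cst.
    by apply: (@bmfun_prod_weight _ _ _ _ (borel X) (borel X)) => l; exact: bmfun_continuous.
  move=> z; apply: convex_sum_dist_le.
  - by move=> p; exact: prod_weight_ge0.
  - by apply: prod_weight_sum => x; apply: (phi1 x) => //; rewrite mdistxx divr_gt0.
  move=> p /prod_weight_gt0[]// /phid d1 /phid d2.
  by rewrite (le_trans (mdist_dist_le _ _ _ _))// mulr_natl mulr2n lerD// ltW.
apply: (@measurable_fun_cvg _ _ _ _ h) => [n|z _]; first by have [] := hP n.
apply/cvgrPdist_le => e e0; near=> n.
have [_ /(_ z)] := hP n; rewrite distrC => /le_trans; apply.
rewrite -ler_pdivlMl// ltW//; near: n.
have e2 : 0 < 2^-1 * e by rewrite mulr_gt0.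
exact: (near_infty_natSinv_lt (PosNum e2)).
Unshelve. all: by end_near. Qed.

(** * Mixtures, couplings and transport costs *)

Section mixture.
Context d (T : measurableType d) (R : realType) (beta : probability T R).
Context (J : finType) (psi : J -> T -> R) (r : J -> R).

(** Density with respect to [beta] of the convex combination, with weights [r], of the measures
    [psi j * beta] normalized to mass one. When [psi j] has integral zero the quotient is zero by
    convention, and the assumption [r_eq0] below ensures that no mass is lost. *)
Definition mixture_density (x : T) := \sum_j r j / (\int[beta]_y psi j y) * psi j x.

Hypotheses (psi_bm : forall j, bounded_measurable (psi j))
  (psi_ge0 : forall j x, 0 <= psi j x) (r_ge0 : forall j, 0 <= r j)
  (r_sum : \sum_j r j = 1)
  (r_eq0 : forall j, \int[beta]_y psi j y = 0 -> r j = 0).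

Let b j := \int[beta]_y psi j y.

Let b_ge0 j : 0 <= b j. Proof. exact: Rintegral_ge0. Qed.

Let r_bK j : r j / b j * b j = r j.
Proof.
have [bj0|bj0] := eqVneq (b j) 0; first by rewrite bj0 mulr0 r_eq0.
by rewrite divfK.
Qed.

Lemma bmfun_mixture : bounded_measurable mixture_density.
Proof. by apply: bmfun_sum => j; exact: bmfunZ. Qed.

Lemma mixture_density_ge0 x : 0 <= mixture_density x.
Proof. by apply: sumr_ge0 => j _; rewrite mulr_ge0// divr_ge0//; exact: b_ge0. Qed.

Lemma Rintegral_mixture_density (f : T -> R) : bounded_measurable f ->
  \int[beta]_x (f x * mixture_density x) =
  \sum_j r j / (\int[beta]_y psi j y) * \int[beta]_x (f x * psi j x).
Proof.
move=> bf; transitivity (\int[beta]_x (\sum_j r j / b j * (f x * psi j x))).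
  apply: eq_Rintegral => x _; rewrite mulr_sumr.
  by apply: eq_bigr => j _; rewrite mulrCA.
rewrite bmfun_Rintegral_sum; last by move=> j; exact/bmfunZ/bmfunM.
by apply: eq_bigr => j _; rewrite bmfun_RintegralZl//; exact: bmfunM.
Qed.

Lemma exists_mixture : exists mu : probability T R, is_density beta mu mixture_density.
Proof.
apply: bmfun_is_density; [exact: bmfun_mixture|exact: mixture_density_ge0|].
have := Rintegral_mixture_density (bmfun_cst T 1).
under eq_Rintegral do rewrite mul1r.
move=> ->; rewrite -[RHS]r_sum; apply: eq_bigr => j _.
rewrite -[RHS]r_bK; congr (_ * _).
by apply: eq_Rintegral => x _; rewrite mul1r.
Qed.

Variable mu : probability T R.
Hypothesis muP : is_density beta mu mixture_density.

Lemma Rintegral_mixture (f : T -> R) : bounded_measurable f ->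
  \int[mu]_x f x = \sum_j r j / (\int[beta]_y psi j y) * \int[beta]_x (f x * psi j x).
Proof.
move=> bf; have [_ ->] := Rintegral_is_density muP bf.
exact: Rintegral_mixture_density.
Qed.

Lemma Rintegral_mixture_le (f : T -> R) (C : J -> R) : bounded_measurable f ->
  (forall j x, 0 < psi j x -> f x <= C j) ->
  \int[mu]_x f x <= \sum_j r j * C j.
Proof.
move=> bf fC; rewrite Rintegral_mixture//; apply: ler_sum => j _.
rewrite -[X in X * C j](r_bK j) -[leRHS]mulrA.
apply: ler_wpM2l; first by apply: divr_ge0 => //; exact: b_ge0.
rewrite -bmfun_RintegralZr//; apply: le_bmfun_Rintegral.
- exact: bmfunM.
- by apply: bmfunM => //; exact: bmfun_cst.
move=> x; have := psi_ge0 j x; rewrite le_eqVlt => /predU1P[<-|p0].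
  by rewrite mulr0 mul0r.
by rewrite mulrC ler_pM2l// fC.
Qed.

End mixture.

Lemma Rintegral_product d1 d2 (T1 : measurableType d1) (T2 : measurableType d2)
    (R : realType) (m1 : probability T1 R) (m2 : probability T2 R)
    (m : probability (T1 * T2)%type R) (f : T1 -> R) (g : T2 -> R) :
  (forall A, measurable A -> m A = (m1 \x m2)%E A) ->
  bounded_measurable f -> bounded_measurable g ->
  \int[m]_z (f z.1 * g z.2) = \int[m1]_x f x * \int[m2]_y g y.
Proof.
move=> mE bf bg.
have bfg : bounded_measurable (fun z : T1 * T2 => f z.1 * g z.2).
  by apply: bmfunM; [exact: bmfun_comp measurable_fst bf|exact: bmfun_comp measurable_snd bg].
transitivity (fine (\int[(m1 \x m2)%E]_z (f z.1 * g z.2)%:E)%E).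
  by congr fine; apply: eq_measure_integral => A mA _; exact: mE.
rewrite -integral12_prod_meas1; last exact: bmfun_integrable.
rewrite /fubini_F /= -bmfun_RintegralZr//; congr fine.
apply: eq_integral => x _.
by rewrite -(bmfun_RintegralZl m2 (f x) bg) integral_EFin_Rintegral//;
  apply: bmfun_integrable; exact: bmfunZ.
Qed.

Lemma exists_product d1 d2 (T1 : measurableType d1) (T2 : measurableType d2)
    (R : realType) (m1 : probability T1 R) (m2 : probability T2 R) :
  exists m : probability (T1 * T2)%type R,
    forall A, measurable A -> m A = (m1 \x m2)%E A.
Proof. by exists (m1 \x m2)%E. Qed.

(** * Squared transport distance on a compact space *)

Section transport.
Context (R : realType) (X : pmetricType R).
Implicit Types (mu nu : probability (borel X) R).
Hypothesis cX : compact [set: X].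

Definition real_cost (p : probability (borel X * borel X)%type R) : R :=
  \int[p]_z (@mdist R X z.1 z.2 ^+ 2).

(** The infimum of the costs itself, without the square root in [W2]; on a compact space costs are
    bounded, so [fine] loses nothing. *)
Definition W2sq mu nu : R := fine (ereal_inf [set transport_cost p | p in couplings mu nu]).

Lemma bmfun_mdist2 : bounded_measurable
  (fun z : borel X * borel X => @mdist R X z.1 z.2 ^+ 2).
Proof.
have [D D0 XD] := compact_mdist_bounded cX.
split; first by apply: measurable_funX; exact: measurable_mdist.
exists (D ^+ 2) => z; rewrite normrX ger0_norm ?mdist_ge0//.
by rewrite lerXn2r ?nnegrE ?mdist_ge0 ?(ltW D0).
Qed.

Lemma transport_costE p : transport_cost p = (real_cost p)%:E.
Proof. exact/integral_EFin_Rintegral/bmfun_integrable/bmfun_mdist2. Qed.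

Lemma real_cost_ge0 p : 0 <= real_cost p.
Proof. by apply: Rintegral_ge0 => z _; rewrite sqr_ge0. Qed.

Lemma couplings_nonempty mu nu : couplings mu nu !=set0.
Proof.
have [p pE] := exists_product mu nu; exists p => A mA.
have pT := (probability_setT mu, probability_setT nu).
by split; (rewrite pE; last exact: measurableX);
  rewrite product_measure1E//= pT (mule1, mul1e).
Qed.

Lemma W2sqP mu nu :
  ereal_inf [set transport_cost p | p in couplings mu nu] = (W2sq mu nu)%:E.
Proof.
rewrite /W2sq fineK// fin_real//; apply/andP; split.
  apply: (@lt_le_trans _ _ 0%E); first exact: ltNyr.
  by apply: le_ereal_inf_tmp => _ [p _ <-]; rewrite transport_costE lee_fin real_cost_ge0.
have [p pc] := couplings_nonempty mu nu.
apply: (@le_lt_trans _ _ (transport_cost p)); last by rewrite transport_costE ltry.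
by apply: ereal_inf_lbound; exists p.
Qed.

Lemma W2sq_ge0 mu nu : 0 <= W2sq mu nu.
Proof.
rewrite -lee_fin -W2sqP; apply: le_ereal_inf_tmp => _ [p _ <-].
by rewrite transport_costE lee_fin real_cost_ge0.
Qed.

Lemma W2_sqr mu nu : (W2 mu nu ^+ 2 = (W2sq mu nu)%:E)%E.
Proof.
rewrite /W2 W2sqP poweR12_sqrt ?sqr_sqrte// ?lee_fin ?W2sq_ge0//.
Qed.

Lemma W2sq_le mu nu p : couplings mu nu p -> W2sq mu nu <= real_cost p.
Proof.
by move=> pc; rewrite -lee_fin -W2sqP -transport_costE; apply: ereal_inf_lbound; exists p.
Qed.

Lemma W2sq_lt mu nu (e : R) : 0 < e ->
  exists2 p, couplings mu nu p & real_cost p < W2sq mu nu + e.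
Proof.
move=> e0; have : (ereal_inf [set transport_cost p | p in couplings mu nu] <
    (W2sq mu nu + e)%:E)%E by rewrite W2sqP lte_fin ltrDl.
move=> /ereal_inf_lt[_ [p pc <-]]; rewrite transport_costE lte_fin => lt.
by exists p.
Qed.

Lemma W2sq_le_diam D mu nu : 0 <= D -> (forall x y : X, mdist x y <= D) ->
  W2sq mu nu <= D ^+ 2.
Proof.
move=> D0 XD; have [p pc] := couplings_nonempty mu nu.
rewrite (le_trans (W2sq_le pc))// -(Rintegral_cstT p (D ^+ 2)).
apply: le_bmfun_Rintegral; [exact: bmfun_mdist2|exact: bmfun_cst|].
by move=> z; rewrite lerXn2r// nnegrE mdist_ge0.
Qed.

Lemma couplings_Rintegral mu nu p (f : borel X -> R) : couplings mu nu p ->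
  bounded_measurable f ->
  \int[p]_z f z.1 = \int[mu]_x f x /\ \int[p]_z f z.2 = \int[nu]_x f x.
Proof.
move=> pc bf; split.
  symmetry; apply: (Rintegral_pushforward (h := fst) measurable_fst _ bf).
  move=> A mA; have [<- _] := pc A mA; congr (p _).
  by apply/seteqP; split => z /=; [case|split].
symmetry; apply: (Rintegral_pushforward (h := snd) measurable_snd _ bf).
move=> A mA; have [_ <-] := pc A mA; congr (p _).
by apply/seteqP; split => z /=; [case|split].
Qed.

End transport.

(** * Transfer kernels *)

(** At each point the weights form a convex combination of values within [k] of [f x]. This is how
    integrals of [f] are replaced by finite sums, with an error independent of the measure. *)
Lemma Rintegral_weights_dist_le d (T : measurableType d) (R : realType)
    (mu : probability T R) (J : finType) (w : J -> T -> R) (a : J -> R)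
    (f : T -> R) (k : R) :
  (forall j, bounded_measurable (w j)) -> (forall j x, 0 <= w j x) ->
  (forall x, \sum_j w j x = 1) -> bounded_measurable f ->
  (forall j x, 0 < w j x -> `|a j - f x| <= k) ->
  `|\sum_j (\int[mu]_x w j x) * a j - \int[mu]_x f x| <= k.
Proof.
move=> wb w0 w1 bf waf.
have -> : \sum_j (\int[mu]_x w j x) * a j = \int[mu]_x (\sum_j w j x * a j).
  rewrite bmfun_Rintegral_sum => [|j]; last by apply: bmfunM => //; exact: bmfun_cst.
  by apply: eq_bigr => j _; rewrite bmfun_RintegralZr.
apply: bmfun_Rintegral_dist_le => //.
  by apply: bmfun_sum => j; apply: bmfunM => //; exact: bmfun_cst.
by move=> x; apply: convex_sum_dist_le => // j; exact: waf.
Qed.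

Lemma Rintegral_weights_sum d (T : measurableType d) (R : realType)
    (mu : probability T R) (J : finType) (w : J -> T -> R) :
  (forall j, bounded_measurable (w j)) -> (forall x, \sum_j w j x = 1) ->
  \sum_j \int[mu]_x w j x = 1.
Proof.
move=> wb w1; rewrite -bmfun_Rintegral_sum//.
by under eq_Rintegral do rewrite w1; exact: Rintegral_cstT.
Qed.

Lemma expR_tangent (R : realType) (t s : R) : expR t * (1 + (s - t)) <= expR s.
Proof.
by rewrite -[in leRHS](subrKC t s) expRD ler_pM2l ?expR_gt0// expR_ge1Dx.
Qed.

Section transfer.
Context d1 d2 (T1 : measurableType d1) (T2 : measurableType d2) (R : realType).
Variables (m1 : probability T1 R) (m2 : probability T2 R) (I : finType).
Variables (psi1 : I -> T1 -> R) (psi2 : I -> T2 -> R).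
Hypotheses (bm1 : forall l, bounded_measurable (psi1 l))
  (bm2 : forall l, bounded_measurable (psi2 l))
  (psi1_ge0 : forall l x, 0 <= psi1 l x) (psi2_ge0 : forall l x, 0 <= psi2 l x)
  (psi1_sum : forall x, \sum_l psi1 l x = 1)
  (psi2_sum : forall x, \sum_l psi2 l x = 1)
  (psi2_gt0 : forall l, 0 < \int[m2]_y psi2 l y).

(* The image of [sigma] under the Markov kernel
   [x |-> \sum_l psi1 l x * (psi2 l * m2) / (m2-mass of psi2 l)]. *)
Definition transfer_density (sigma : probability T1 R) : T2 -> R :=
  mixture_density m2 psi2 (fun l => \int[sigma]_x psi1 l x).

Let r_ge0 (sigma : probability T1 R) l : 0 <= \int[sigma]_x psi1 l x.
Proof. exact: Rintegral_ge0. Qed.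

Let r_eq0 (sigma : probability T1 R) l :
  \int[m2]_y psi2 l y = 0 -> \int[sigma]_x psi1 l x = 0.
Proof. by move=> h; have := psi2_gt0 l; rewrite h ltxx. Qed.

Lemma exists_transfer (sigma : probability T1 R) :
  exists tau : probability T2 R, is_density m2 tau (transfer_density sigma).
Proof.
apply: exists_mixture => //.
  exact: Rintegral_weights_sum.
exact: r_eq0.
Qed.

Variables (sigma : probability T1 R) (tau : probability T2 R).
Hypothesis tauP : is_density m2 tau (transfer_density sigma).

(** Both integrals are compared with the sum of [F l] weighted by the masses of [psi1 l] under
    [sigma], each comparison costing [k]. In applications [F l] is the value of a common function at
    the centre of cell [l]. *)
Lemma transfer_Rintegral_dist_le (f1 : T1 -> R) (f2 : T2 -> R) (F : I -> R) (k : R) :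
  bounded_measurable f1 -> bounded_measurable f2 ->
  (forall l x, 0 < psi1 l x -> `|F l - f1 x| <= k) ->
  (forall l y, 0 < psi2 l y -> `|F l - f2 y| <= k) ->
  `|\int[tau]_y f2 y - \int[sigma]_x f1 x| <= 2 * k.
Proof.
move=> bf1 bf2 F1 F2.
have := Rintegral_weights_dist_le sigma bm1 psi1_ge0 psi1_sum bf1 F1.
have rsum := Rintegral_weights_sum sigma bm1 psi1_sum.
have mixE (G : I -> R) : \sum_l (\int[sigma]_x psi1 l x) * (G l + k) =
    \sum_l (\int[sigma]_x psi1 l x) * G l + k.
  under eq_bigr do rewrite mulrDr.
  by rewrite big_split/= -mulr_suml rsum mul1r.
have := Rintegral_mixture_le bm2 psi2_ge0 (r_ge0 sigma) (@r_eq0 sigma) tauP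
  (C := fun l => F l + k) bf2.
have := Rintegral_mixture_le bm2 psi2_ge0 (r_ge0 sigma) (@r_eq0 sigma) tauP
  (C := fun l => - F l + k) (bmfunZ (-1) bf2).
rewrite !mixE bmfun_RintegralZl//.
under eq_bigr do rewrite mulrN.
rewrite sumrN.
set S := \sum_(l in I) _; set a := \int[tau]_y f2 y; set b := \int[sigma]_x f1 x.
move=> h1 h2; have {}h1 : -1 * a <= - S + k.
  by apply: h1 => l y /F2; rewrite ler_norml; lra.
have {}h2 : a <= S + k by apply: h2 => l y /F2; rewrite ler_norml; lra.
by rewrite !ler_norml; lra.
Qed.

(** The adjoint kernel turns [f] into [F], a combination of the averages [g l] of [f] over the
    cells, so that integrating [f] against [tau] is integrating [F] against [sigma]. Jensen's
    inequality is applied on each side, and the comparison of cell masses in between costs the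
    factor [exp k]. *)
Lemma transfer_entropy_dual (C k : R) :
  (forall l, \int[m1]_x psi1 l x <= expR k * \int[m2]_y psi2 l y) ->
  entropy_dual m1 sigma C -> entropy_dual m2 tau (C + k).
Proof.
move=> a12 H f bf.
pose g l := (\int[m2]_y (f y * psi2 l y)) / \int[m2]_y psi2 l y.
pose F x := \sum_l psi1 l x * g l.
have bF : bounded_measurable F.
  by apply: bmfun_sum => l; apply: bmfunM => //; exact: bmfun_cst.
have -> : \int[tau]_y f y = \int[sigma]_x F x.
  rewrite (Rintegral_mixture bm2 tauP bf) bmfun_Rintegral_sum; last first.
    by move=> l; apply: bmfunM => //; exact: bmfun_cst.
  by apply: eq_bigr => l _; rewrite bmfun_RintegralZr// -mulrA; congr (_ * _); rewrite mulrC.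
have bc1 (r : R) : bounded_measurable (fun _ : T1 => r) by exact: bmfun_cst.
have bc2 (r : R) : bounded_measurable (fun _ : T2 => r) by exact: bmfun_cst.
(* Shifting the test function by [k] adds [k] to the constant and multiplies the exponential
   integral by [exp (- k)], which absorbs the ratio of the cell masses. *)
have := H _ (bmfunB bF (bc1 k)).
rewrite bmfun_RintegralB// Rintegral_cstT lerBlDr => /le_trans; apply.
rewrite addrAC lerD2l.
have -> : \int[m1]_x expR (F x - k - 1) = expR (- k) * \int[m1]_x expR (F x - 1).
  rewrite -bmfun_RintegralZl; last by apply: bmfun_expR; do !apply: bmfunB.
  by apply: eq_Rintegral => x _; rewrite -expRD; congr expR; ring.
rewrite expRN ler_pdivrMl ?expR_gt0//.
(* Jensen for the finite weights [psi1 l x]: in the tangent bound at [F x - 1] the linear terms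
   cancel, as [F x] is the mean of the [g l]. *)
apply: (@le_trans _ _ (\int[m1]_x \sum_l psi1 l x * expR (g l - 1))).
  apply: le_bmfun_Rintegral; first by apply: bmfun_expR; do !apply: bmfunB.
    by apply: bmfun_sum => l; exact: bmfunM.
  move=> x; rewrite -[leLHS]mulr1.
  apply: (@le_trans _ _ (\sum_l psi1 l x *
      (expR (F x - 1) * (1 + ((g l - 1) - (F x - 1)))))); last first.
    by apply: ler_sum => l _; rewrite ler_wpM2l// expR_tangent.
  rewrite (eq_bigr (fun l => expR (F x - 1) * (psi1 l x + (psi1 l x * g l - psi1 l x * F x)))).
    rewrite -mulr_sumr big_split/= sumrB -mulr_suml psi1_sum mul1r.
    by rewrite -/(F x) subrr addr0.
  by move=> l _; ring.
rewrite bmfun_Rintegral_sum; last by move=> l; exact: bmfunM.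
have -> : \int[m2]_y expR (f y - 1) = \sum_l \int[m2]_y (psi2 l y * expR (f y - 1)).
  rewrite -bmfun_Rintegral_sum => [|l]; last first.
    by apply: bmfunM => //; apply: bmfun_expR; exact: bmfunB.
  by apply: eq_Rintegral => y _; rewrite -mulr_suml psi2_sum mul1r.
rewrite mulr_sumr; apply: ler_sum => l _; rewrite bmfun_RintegralZr//.
apply: (@le_trans _ _ (expR k * \int[m2]_y psi2 l y * expR (g l - 1))).
  by rewrite ler_wpM2r ?expR_ge0.
rewrite -mulrA ler_wpM2l ?expR_ge0//.
(* Jensen for the measure [psi2 l * m2], with the tangent at [g l - 1]: the left-hand side is
   written as the integral of the tangent line, whose linear part vanishes because [g l] is the
   average of [f]. *)
have -> : (\int[m2]_y psi2 l y) * expR (g l - 1) =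
    \int[m2]_y (expR (g l - 1) * ((1 - g l) * psi2 l y + f y * psi2 l y)).
  rewrite bmfun_RintegralZl; last by apply: bmfunD; [exact: bmfunZ|exact: bmfunM].
  rewrite bmfun_RintegralD ?bmfun_RintegralZl//; [|exact: bmfunZ|exact: bmfunM].
  have -> : \int[m2]_y (f y * psi2 l y) = g l * \int[m2]_y psi2 l y.
    by rewrite /g divfK// gt_eqF.
  by ring.
apply: le_bmfun_Rintegral.
- by apply: bmfunZ; apply: bmfunD; [exact: bmfunZ|exact: bmfunM].
- by apply: bmfunM => //; by apply: bmfun_expR; do !apply: bmfunB.
move=> y; have := ler_wpM2l (psi2_ge0 l y) (expR_tangent (g l - 1) (f y - 1)).
apply: le_trans; rewrite le_eqVlt; apply/orP; left; apply/eqP; ring.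
Qed.

End transfer.

(** * Couplings built from finite matrices *)

Section coupling_matrix.
Context (R : realType) (X : pmetricType R) (I : finType).
Variables (nu1 nu2 sigma1 sigma2 : probability (borel X) R).
Variables (psi : I -> borel X -> R) (c C : I * I -> R).
Hypotheses (cX : compact [set: X])
  (bm : forall l, bounded_measurable (psi l)) (psi_ge0 : forall l x, 0 <= psi l x)
  (c_ge0 : forall p, 0 <= c p) (c_sum : \sum_p c p = 1)
  (c_eq01 : forall p, \int[nu1]_x psi p.1 x = 0 -> c p = 0)
  (c_eq02 : forall p, \int[nu2]_x psi p.2 x = 0 -> c p = 0)
  (sigma1P : is_density nu1 sigma1
     (mixture_density nu1 psi (fun l => \sum_l' c (l, l'))))
  (sigma2P : is_density nu2 sigma2
     (mixture_density nu2 psi (fun l' => \sum_l c (l, l'))))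
  (C_le : forall p (x y : X), 0 < psi p.1 x -> 0 < psi p.2 y -> mdist x y ^+ 2 <= C p).

(* The coupling has density [\sum_p c p * psi p.1 x * psi p.2 y], suitably
   normalized, with respect to the product of [nu1] and [nu2]. *)
Lemma W2sq_matrix_le : W2sq sigma1 sigma2 <= \sum_p c p * C p.
Proof.
have [m mE] := exists_product nu1 nu2.
pose w := prod_weight psi psi : I * I -> borel X * borel X -> R.
have wb p : bounded_measurable (w p) by exact: bmfun_prod_weight.
have w0 p z : 0 <= w p z by exact: prod_weight_ge0.
have wE p : \int[m]_z w p z = (\int[nu1]_x psi p.1 x) * \int[nu2]_x psi p.2 x.
  exact: Rintegral_product.
have cw0 p : \int[m]_z w p z = 0 -> c p = 0.
  by rewrite wE => /eqP; rewrite mulf_eq0 => /orP[]/eqP; [exact: c_eq01|exact: c_eq02].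
have [q qP] := exists_mixture wb w0 c_ge0 c_sum cw0.
have qpc : couplings sigma1 sigma2 q.
  move=> A mA; have bA := bmfun_indic R mA.
  have fineE (B : set (borel X * borel X)) (sigma : probability (borel X) R) :
      (* Marginals are compared through real integrals of indicators, to which the mixture formula
         applies. *)
      measurable B -> \int[q]_z \1_B z = \int[sigma]_x \1_A x -> q B = sigma A.
    move=> mB; rewrite !Rintegral_indicT// => h.
    by rewrite -[LHS]fineK ?fin_num_measure// h fineK ?fin_num_measure.
  split; apply: fineE; try exact: measurableX.
  - transitivity (\int[q]_z \1_A z.1).
      by apply: eq_Rintegral => z _; rewrite !indicE in_setX in_setT andbT.
    rewrite (Rintegral_mixture wb qP (bmfun_comp measurable_fst bA)).
    rewrite (Rintegral_mixture bm sigma1P bA).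
    under [RHS]eq_bigr do rewrite !mulr_suml.
    rewrite (pair_bigA _ (fun l l' => c (l, l') / (\int[nu1]_x psi l x) *
      \int[nu1]_x (\1_A x * psi l x))); apply: eq_bigr => -[l l'] _ /=.
    have -> : \int[m]_z (\1_A z.1 * w (l, l') z) =
        (\int[nu1]_x (\1_A x * psi l x)) * \int[nu2]_x psi l' x.
      rewrite -(Rintegral_product mE); [|exact: bmfunM|exact: bm].
      by apply: eq_Rintegral => z _; rewrite mulrA.
    (* A second factor of mass zero forces the entry of [c] to vanish; otherwise that mass cancels
       against the normalization. *)
    rewrite wE /=; have [e|e] := eqVneq (\int[nu2]_x psi l' x) 0.
      by rewrite (c_eq02 (p := (l, l')) e) !mul0r.
    by rewrite invfM -!mulrA; congr (_ * (_ * _)); rewrite mulrCA mulVf// mulr1.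
  - transitivity (\int[q]_z \1_A z.2).
      by apply: eq_Rintegral => z _; rewrite !indicE in_setX in_setT.
    rewrite (Rintegral_mixture wb qP (bmfun_comp measurable_snd bA)).
    rewrite (Rintegral_mixture bm sigma2P bA).
    under [RHS]eq_bigr do rewrite !mulr_suml.
    rewrite exchange_big/=.
    rewrite (pair_bigA _ (fun l l' => c (l, l') / (\int[nu2]_x psi l' x) *
      \int[nu2]_x (\1_A x * psi l' x))); apply: eq_bigr => -[l l'] _ /=.
    have -> : \int[m]_z (\1_A z.2 * w (l, l') z) =
        (\int[nu1]_x psi l x) * \int[nu2]_x (\1_A x * psi l' x).
      rewrite -(Rintegral_product mE); [|exact: bm|exact: bmfunM].
      by apply: eq_Rintegral => z _; rewrite mulrCA.
    rewrite wE /=; have [e|e] := eqVneq (\int[nu1]_x psi l x) 0.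
      by rewrite (c_eq01 (p := (l, l')) e) !mul0r.
    by rewrite invfM -!mulrA; congr (_ * _); rewrite mulrCA; congr (_ * _);
      rewrite mulKf.
apply: (le_trans (W2sq_le cX qpc)).
apply: (Rintegral_mixture_le wb w0 c_ge0 cw0 qP (bmfun_mdist2 cX)) => p z.
by move=> /prod_weight_gt0[]//; exact: C_le.
Qed.

End coupling_matrix.

(** The mixture density is the sum of those [psi l] with nonzero integral. The others vanish
    [nu]-almost everywhere, so the sum is 1 almost everywhere. This allows [W2sq_matrix_le] to be
    used with the marginals themselves as reference measures. *)
Lemma is_density_self d (T : measurableType d) (R : realType)
    (nu : probability T R) (I : finType) (psi : I -> T -> R) :
  (forall l, bounded_measurable (psi l)) -> (forall l x, 0 <= psi l x) ->
  (forall x, \sum_l psi l x = 1) ->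
  is_density nu nu (mixture_density nu psi (fun l => \int[nu]_x psi l x)).
Proof.
move=> bm psi0 psi1.
have r0 l : 0 <= \int[nu]_x psi l x by exact: Rintegral_ge0.
have bmix := bmfun_mixture nu (fun l => \int[nu]_x psi l x) bm.
have mix0 := mixture_density_ge0 nu psi0 r0.
split => //; first by case: bmix.
move=> A mA; have bA := bmfun_indic R mA.
have -> : (\int[nu]_(x in A) (mixture_density nu psi (fun l => \int[nu]_x psi l x) x)%:E =
  \int[nu]_x (\1_A x * mixture_density nu psi (fun l => \int[nu]_x psi l x) x)%:E)%E.
  rewrite integral_mkcond; apply: eq_integral => x _.
  by rewrite patchE indicE; case: (x \in A); rewrite ?mul1r ?mul0r.
rewrite integral_EFin_Rintegral; last exact/bmfun_integrable/bmfunM.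
rewrite Rintegral_mixture_density// -[LHS]fineK ?fin_num_measure//; congr EFin.
rewrite -(Rintegral_indicT nu mA).
transitivity (\int[nu]_x (\sum_l \1_A x * psi l x)).
  by apply: eq_Rintegral => x _; rewrite -mulr_sumr psi1 mulr1.
rewrite bmfun_Rintegral_sum; last by move=> l; exact: bmfunM.
apply: eq_bigr => l _.
have [e|e] := eqVneq (\int[nu]_x psi l x) 0; last by rewrite divff// mul1r.
rewrite e mul0r mul0r; apply/eqP; rewrite eq_le; apply/andP; split; last first.
  by apply: Rintegral_ge0 => x _; rewrite mulr_ge0.
rewrite -[leRHS]e; apply: le_bmfun_Rintegral => //; first exact: bmfunM.
by move=> x; rewrite indicE; case: (x \in A); rewrite ?mul1r ?mul0r.
Qed.

(** * Discretizing couplings by a partition of unity *)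

Section transport_transfer.
Context (R : realType) (Z : pmetricType R) (D e : R) (I : finType).
Variables (ctr : I -> Z) (phi : I -> Z -> R).
Hypotheses (ZD : forall x y : Z, mdist x y <= D)
  (phi_cont : forall l, continuous (phi l)) (phi01 : forall l z, 0 <= phi l z <= 1)
  (phi_dist : forall l z, 0 < phi l z -> mdist (ctr l) z < e).

Let C (p : I * I) := mdist (ctr p.1) (ctr p.2) ^+ 2.

Let phi_ge0 l z : 0 <= phi l z. Proof. by have /andP[] := phi01 l z. Qed.

(** Difference of squares: the distances differ by at most [2 * e] and sum to at most [2 * D]. *)
Lemma sqr_mdist_dist_le p (x y : Z) : 0 < phi p.1 x -> 0 < phi p.2 y ->
  `|C p - mdist x y ^+ 2| <= 4 * (D * e).
Proof.
move=> /phi_dist px /phi_dist py.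
have := mdist_dist_le (ctr p.1) (ctr p.2) x y.
rewrite subr_sqr normrM => h.
have h1 : `|mdist (ctr p.1) (ctr p.2) - mdist x y| <= 2 * e by lra.
have h2 : `|mdist (ctr p.1) (ctr p.2) + mdist x y| <= 2 * D.
  rewrite ger0_norm ?addr_ge0 ?mdist_ge0//.
  have := ZD (ctr p.1) (ctr p.2); have := ZD x y; lra.
by rewrite (_ : 4 * (D * e) = 2 * e * (2 * D)); [exact: ler_pM|ring].
Qed.

Variables (X : pmetricType R) (i : X -> Z).
Hypotheses (cX : compact [set: X]) (iso : isometric_embedding i)
  (phi_sum : forall x, \sum_l phi l (i x) = 1).

Let psi l (x : borel X) := phi l (i x).

Let psi_ge0 l x : 0 <= psi l x. Proof. exact: phi_ge0. Qed.

Lemma psi_bm l : bounded_measurable (psi l).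
Proof.
apply: (@bmfun_continuous R X (phi l \o i)) => x /=; last exact: phi01.
by apply: continuous_comp; [exact: isometric_continuous|exact: phi_cont].
Qed.

Definition coupling_matrix (q : probability (borel X * borel X)%type R) (p : I * I) :=
  \int[q]_z prod_weight psi psi p z.

Lemma coupling_matrix_ge0 q p : 0 <= coupling_matrix q p.
Proof. by apply: Rintegral_ge0 => z _; exact: (prod_weight_ge0 psi_ge0 psi_ge0). Qed.

Lemma coupling_matrix_sum q : \sum_p coupling_matrix q p = 1.
Proof.
apply: Rintegral_weights_sum => [p|z]; last exact: (prod_weight_sum phi_sum phi_sum).
by apply: bmfun_prod_weight; exact: psi_bm.
Qed.

Lemma coupling_matrix_suml q sigma1 sigma2 l : couplings sigma1 sigma2 q ->
  \sum_l' coupling_matrix q (l, l') = \int[sigma1]_x psi l x.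
Proof.
move=> qc; have [<- _] := couplings_Rintegral qc (psi_bm l).
rewrite -bmfun_Rintegral_sum => [|l']; last by apply: bmfun_prod_weight; exact: psi_bm.
by apply: eq_Rintegral => z _; rewrite /prod_weight /= -mulr_sumr phi_sum mulr1.
Qed.

Lemma coupling_matrix_sumr q sigma1 sigma2 l' : couplings sigma1 sigma2 q ->
  \sum_l coupling_matrix q (l, l') = \int[sigma2]_x psi l' x.
Proof.
move=> qc; have [_ <-] := couplings_Rintegral qc (psi_bm l').
rewrite -bmfun_Rintegral_sum => [|l]; last by apply: bmfun_prod_weight; exact: psi_bm.
by apply: eq_Rintegral => z _; rewrite /prod_weight /= -mulr_suml phi_sum mul1r.
Qed.

Lemma coupling_matrix_cost q :
  \sum_p coupling_matrix q p * C p <= real_cost q + 4 * (D * e).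
Proof.
have := @Rintegral_weights_dist_le _ _ _ q _ (prod_weight psi psi) C
  (fun z => @mdist R X z.1 z.2 ^+ 2) (4 * (D * e)).
rewrite -lerBlDl => h; apply: (le_trans (ler_norm _)); apply: h.
- by move=> p; apply: bmfun_prod_weight; exact: psi_bm.
- exact: (prod_weight_ge0 psi_ge0 psi_ge0).
- exact: (prod_weight_sum phi_sum phi_sum).
- exact: bmfun_mdist2.
- move=> p z /(prod_weight_gt0 psi_ge0 psi_ge0)[] p1 p2; rewrite -(iso z.1 z.2).
  exact: sqr_mdist_dist_le.
Qed.

Lemma mdist2_le_matrix p (x y : X) : 0 < psi p.1 x -> 0 < psi p.2 y ->
  mdist x y ^+ 2 <= C p + 4 * (D * e).
Proof.
by rewrite -iso => p1 p2; have := sqr_mdist_dist_le p1 p2; rewrite ler_norml; lra.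
Qed.

(** The way back from matrices to measures: [c] need not come from a coupling of [nu1] and [nu2],
    only its marginals must match. It will be applied to a limit of coupling matrices. *)
Lemma W2sq_le_matrix (nu1 nu2 : probability (borel X) R) (c : I * I -> R) :
  (forall p, 0 <= c p) -> \sum_p c p = 1 ->
  (forall l, \sum_l' c (l, l') = \int[nu1]_x psi l x) ->
  (forall l', \sum_l c (l, l') = \int[nu2]_x psi l' x) ->
  W2sq nu1 nu2 <= \sum_p c p * C p + 4 * (D * e).
Proof.
move=> c0 c1 cl cr.
have -> : \sum_p c p * C p + 4 * (D * e) = \sum_p c p * (C p + 4 * (D * e)).
  by under [RHS]eq_bigr do rewrite mulrDr; rewrite big_split/= -mulr_suml c1 mul1r.
apply: (@W2sq_matrix_le R X I nu1 nu2 nu1 nu2 psi) => //.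
- exact: psi_bm.
(* A nonnegative entry is at most its row sum, so it vanishes on cells of mass zero. *)
- move=> [l l'] /= e1; apply/eqP; rewrite eq_le c0 andbT -e1 -cl.
  by rewrite (bigD1 l')//= lerDl sumr_ge0.
- move=> [l l'] /= e1; apply/eqP; rewrite eq_le c0 andbT -e1 -cr.
  by rewrite (bigD1 l)//= lerDl sumr_ge0.
- rewrite (_ : (fun l => _) = fun l => \int[nu1]_x psi l x); last exact/funext.
  by apply: is_density_self => //; exact: psi_bm.
- rewrite (_ : (fun l => _) = fun l => \int[nu2]_x psi l x); last exact/funext.
  by apply: is_density_self => //; exact: psi_bm.
- exact: mdist2_le_matrix.
Qed.

End transport_transfer.

Section transport_transfer2.
Context (R : realType) (Z : pmetricType R) (D e : R) (I : finType).
Variables (ctr : I -> Z) (phi : I -> Z -> R).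
Hypotheses (ZD : forall x y : Z, mdist x y <= D)
  (phi_cont : forall l, continuous (phi l)) (phi01 : forall l z, 0 <= phi l z <= 1)
  (phi_dist : forall l z, 0 < phi l z -> mdist (ctr l) z < e).
Variables (X Y : pmetricType R) (i : X -> Z) (i' : Y -> Z).
Hypotheses (cX : compact [set: X]) (cY : compact [set: Y])
  (iso : isometric_embedding i) (iso' : isometric_embedding i')
  (phi_sum : forall x, \sum_l phi l (i x) = 1).
Variable m' : probability (borel Y) R.
Hypothesis m'_gt0 : forall l, 0 < \int[m']_y phi l (i' y).

(** The matrix of an almost optimal coupling of [sigma1] and [sigma2] also defines a coupling of
    their images. Discretizing costs [4 * (D * e)], and so does spreading the matrix out again over
    [Y]. *)
Lemma W2sq_transfer_le (sigma1 sigma2 : probability (borel X) R)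
    (tau1 tau2 : probability (borel Y) R) :
  is_density m' tau1 (transfer_density m'
    (fun l (x : borel X) => phi l (i x)) (fun l (y : borel Y) => phi l (i' y)) sigma1) ->
  is_density m' tau2 (transfer_density m'
    (fun l (x : borel X) => phi l (i x)) (fun l (y : borel Y) => phi l (i' y)) sigma2) ->
  W2sq tau1 tau2 <= W2sq sigma1 sigma2 + 8 * (D * e).
Proof.
move=> tau1P tau2P; apply/ler_addgt0Pr => h h0.
have [q qc qlt] := W2sq_lt cX sigma1 sigma2 h0.
pose c := coupling_matrix phi i q.
have c0 p : 0 <= c p by exact: coupling_matrix_ge0.
have c1 : \sum_p c p = 1 by exact: coupling_matrix_sum.
have cl l : \sum_l' c (l, l') = \int[sigma1]_x phi l (i x).
  exact: (coupling_matrix_suml _ _ _ _ _ qc).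
have cr l' : \sum_l c (l, l') = \int[sigma2]_x phi l' (i x).
  exact: (coupling_matrix_sumr _ _ _ _ _ qc).
have : W2sq tau1 tau2 <= \sum_p c p * (mdist (ctr p.1) (ctr p.2) ^+ 2 + 4 * (D * e)).
  apply: (@W2sq_matrix_le R Y I m' m' tau1 tau2 (fun l (y : borel Y) => phi l (i' y))) => //.
  - exact: psi_bm.
  - by move=> l y; have /andP[] := phi01 l (i' y).
  - by move=> p e0; have := m'_gt0 p.1; rewrite e0 ltxx.
  - by move=> p e0; have := m'_gt0 p.2; rewrite e0 ltxx.
  - by rewrite (_ : (fun l => _) = fun l => \int[sigma1]_x phi l (i x))//; exact/funext.
  - by rewrite (_ : (fun l => _) = fun l => \int[sigma2]_x phi l (i x))//; exact/funext.
  - exact: mdist2_le_matrix.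
under eq_bigr do rewrite mulrDr.
rewrite big_split/= -mulr_suml c1 mul1r.
have := coupling_matrix_cost ZD phi_cont phi01 phi_dist cX iso phi_sum q.
rewrite -/c; lra.
Qed.

End transport_transfer2.

(** * Setwise limits along an ultrafilter *)

Lemma exists_ultrafilter_infty : exists2 U : set_system nat, UltraFilter U & \oo `<=` U.
Proof. by have [U [UU Uoo]] := ultraFilterLemma eventually_filter; exists U. Qed.

(** Compactness of [[- M, M]] gives a cluster point, and an ultrafilter converges to each of its
    cluster points. *)
Lemma ultrafilter_bounded_cvg (R : realType) (U : set_system nat) (u : nat -> R) (M : R) :
  UltraFilter U -> (forall n, `|u n| <= M) -> exists l : R, u n @[n --> U] --> l.
Proof.
move=> UU uM.
have [|l [_ lu]] := @segment_compact R (- M) M (u n @[n --> U]) _.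
  by apply: nearW => n /=; rewrite in_itv/= -ler_norml.
exists l => V Vl.
have [//|UV] := in_ultra_setVsetC (u @^-1` V) UU.
by have [t [/=]] := lu (~` V) V UV Vl.
Qed.

Section setwise_limit.
Context d (T : measurableType d) (R : realType) (m : probability T R).
Variables (nu_ : nat -> probability T R) (C : R) (U : set_system nat).
Hypotheses (UU : UltraFilter U) (nu_dual : forall n, entropy_dual m (nu_ n) C).

(* The truncation by 1 only matters on nonmeasurable sets. *)
Definition setwise_lim (A : set T) : R :=
  lim (Num.min 1 (fine (nu_ n A)) @[n --> U]).

Let setwise_cvg A : Num.min 1 (fine (nu_ n A)) @[n --> U] --> setwise_lim A.
Proof.
have [|l ul] := @ultrafilter_bounded_cvg R U (fun n => Num.min 1 (fine (nu_ n A))) 1 UU.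
  move=> n; rewrite ger0_norm ?ge_min ?lexx// le_min ler01/=.
  by rewrite fine_ge0.
by apply/cvg_ex; exists l.
Qed.

Lemma cvg_setwise_lim A : measurable A ->
  \int[nu_ n]_x \1_A x @[n --> U] --> setwise_lim A.
Proof.
move=> mA; have e n : \int[nu_ n]_x \1_A x = Num.min 1 (fine (nu_ n A)).
  rewrite Rintegral_indicT// min_r//.
  by rewrite -lee_fin fineK ?fin_num_measure//; exact: probability_le1.
by rewrite (eq_cvg _ _ e); exact: setwise_cvg.
Qed.

Let setwise_limU A B : measurable A -> measurable B -> [disjoint A & B] ->
  setwise_lim (A `|` B) = setwise_lim A + setwise_lim B.
Proof.
move=> mA mB AB; have h := cvg_setwise_lim (measurableU _ _ mA mB).
have e n : \int[nu_ n]_x \1_(A `|` B) x =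
    \int[nu_ n]_x \1_A x + \int[nu_ n]_x \1_B x.
  rewrite !Rintegral_indicT//; last exact: measurableU.
  rewrite measureU// ?fineD ?fin_num_measure//.
  by apply/eqP; rewrite -disj_set2E.
rewrite (eq_cvg _ _ e) in h; apply: (@cvg_unique _ (@Rhausdorff R) _ _ _ _ h).
by apply: cvgD; exact: cvg_setwise_lim.
Qed.

Let setwise_lim_ge0 A : 0 <= setwise_lim A.
Proof.
apply: limr_ge; first by apply/cvg_ex; exists (setwise_lim A); exact: setwise_cvg.
by apply: nearW => n; rewrite le_min ler01 fine_ge0.
Qed.

Let setwise_lim_le A (s : R) : measurable A -> 0 <= s ->
  s * setwise_lim A <= C + 1 + expR s * fine (m A).
Proof.
move=> mA s0.
have h : s * \int[nu_ n]_x \1_A x @[n --> U] --> s * setwise_lim A.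
  by apply: cvgMr; exact: cvg_setwise_lim.
apply: (cvgr_to_le h); apply: nearW => n.
by rewrite Rintegral_indicT//; exact: entropy_dual_measure_le.
Qed.

Let setwise_lim0 : setwise_lim set0 = 0.
Proof.
have h := cvg_setwise_lim measurable0.
have e n : \int[nu_ n]_x \1_(set0 : set T) x = 0 by rewrite Rintegral_indicT// measure0.
rewrite (eq_cvg _ _ e) in h; apply: (@cvg_unique _ (@Rhausdorff R) _ _ _ _ h).
exact: cvg_cst.
Qed.

Definition setwise_measure (A : set T) : \bar R := (setwise_lim A)%:E.

Let setwise_measure0 : setwise_measure set0 = 0%E.
Proof. by rewrite /setwise_measure setwise_lim0. Qed.

Let setwise_measure_ge0 A : (0 <= setwise_measure A)%E.
Proof. by rewrite lee_fin. Qed.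

(** Finite additivity passes to the limit. For a countable union the remainders [B n] have [m]-mass
    tending to 0, and the uniform absolute continuity provided by the entropy bound makes their
    limit mass tend to 0 as well. *)
Let setwise_measure_sigma_additive : semi_sigma_additive setwise_measure.
Proof.
move=> F mF tF mUF.
pose S n := \big[setU/set0]_(k < n) F k.
have mS n : measurable (S n) by apply: bigsetU_measurable => k _.
have sumE n : (\sum_(0 <= k < n) setwise_measure (F k))%E = (setwise_lim (S n))%:E.
  rewrite big_mkord /S; elim: n => [|n IH]; first by rewrite !big_ord0 setwise_lim0.
  rewrite !big_ord_recr/= IH setwise_limU//; first exact: mS.
  rewrite disj_set2E; apply/eqP; apply: (@trivIset_bigsetUI _ predT F) => //.
  by rewrite /predT /= trueE.
rewrite (eq_cvg _ _ sumE).
apply/cvg_EFin; first by near=> n.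
rewrite (_ : fine \o _ = fun n => setwise_lim (S n))//=.
pose B n := \bigcup_k F k `\` S n.
have mBn n : measurable (B n) by exact: measurableD.
have subB n : S n `<=` \bigcup_k F k by exact: bigsetU_bigcup.
have disSB n : S n `&` B n = set0 by rewrite -subset0 => x [? []].
have unionE n : \bigcup_k F k = S n `|` B n by rewrite setDUK.
have limE n : setwise_lim (\bigcup_k F k) = setwise_lim (S n) + setwise_lim (B n).
  by rewrite -setwise_limU// -?unionE// disj_set2E disSB.
have mB0 : fine (m (B n)) @[n --> \oo] --> 0.
  have e n : fine (m (B n)) = fine (m (\bigcup_k F k)) - fine (m (S n)).
    rewrite [in RHS](unionE n) measureU// fineD ?fin_num_measure// addrC addKr//.
  rewrite (eq_cvg _ _ e).
  have h : fine (m (S n)) @[n --> \oo] --> fine (m (\bigcup_k F k)).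
    apply: fine_cvg; rewrite fineK ?fin_num_measure//.
    have e' n : m (S n) = (\sum_(0 <= k < n) m (F k))%E.
      by rewrite big_mkord measure_bigsetU.
    by rewrite (eq_cvg _ _ e'); exact: measure_semi_sigma_additive.
  have := cvgB (cvg_cst (fine (m (\bigcup_k F k)))) h.
  by rewrite subrr; apply.
apply/cvgrPdist_le => e e0.
(* First [s] is fixed, then [n] is taken so large that both [C + 1] and [exp s * m (B n)] are at
   most half of [s * e]. *)
pose s := 2 * (`|C| + 1) / e.
have C1 : 0 < `|C| + 1 by rewrite ltr_wpDl.
have s0 : 0 < s by rewrite !mulr_gt0// invr_gt0.
near=> n.
have mBs : fine (m (B n)) <= (`|C| + 1) / expR s.
  rewrite (le_trans (ler_norm _))//; near: n.
  by apply: (cvgr0_norm_le _ mB0); rewrite divr_gt0// expR_gt0.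
rewrite (limE n) addrC addKr ger0_norm//.
have := setwise_lim_le (mBn n) (ltW s0).
rewrite ler_pdivlMr ?expR_gt0// in mBs; rewrite mulrC in mBs.
move=> h; rewrite -(ler_pM2l s0) (le_trans h)//.
rewrite /s divfK ?gt_eqF//; have := ler_norm C; lra.
Unshelve. all: by end_near. Qed.
HB.instance Definition _ := isMeasure.Build _ _ _ setwise_measure
  setwise_measure0 setwise_measure_ge0 setwise_measure_sigma_additive.

Let setwise_measure_setT : setwise_measure [set: T] = 1%E.
Proof.
rewrite /setwise_measure; congr EFin; have h := cvg_setwise_lim (@measurableT _ T).
have e n : \int[nu_ n]_x \1_([set: T]) x = 1.
  by rewrite Rintegral_indicT//= probability_setT.
rewrite (eq_cvg _ _ e) in h; apply: (@cvg_unique _ (@Rhausdorff R) _ _ _ _ h).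
exact: cvg_cst.
Qed.

HB.instance Definition _ :=
  @Measure_isProbability.Build _ _ R setwise_measure setwise_measure_setT.

Lemma exists_setwise_limit : exists nu : probability T R,
  forall A, measurable A -> \int[nu_ n]_x \1_A x @[n --> U] --> \int[nu]_x \1_A x.
Proof.
exists setwise_measure => A mA; rewrite Rintegral_indicT//.
exact: cvg_setwise_lim.
Qed.

End setwise_limit.

(* Slicing the range of [f] into intervals of length [e] approximates [f]
   uniformly by a step function. *)
Lemma bmfun_step d (T : measurableType d) (R : realType) (f : T -> R) (e : R) :
  bounded_measurable f -> 0 < e ->
  exists (K : nat) (A : 'I_K -> set T) (a : 'I_K -> R),
    [/\ forall k, measurable (A k), forall x, \sum_k (\1_(A k) x : R) = 1 &
        forall k x, A k x -> `|a k - f x| <= e].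
Proof.
move=> [mf [M fM]] e0.
pose t x := (f x + M) / e.
have M0 : 0 <= M by rewrite (le_trans _ (fM point)).
have t0 x : 0 <= t x.
  by rewrite divr_ge0 ?(ltW e0)//; have := fM x; rewrite ler_norml => /andP[]; lra.
(* The successor is needed because [t] may attain its upper bound [2 * M / e], whose integer part
   must still be an index below [K]. *)
pose K := (Num.trunc (2 * M / e)).+1.
have tK x : (Num.trunc (t x) < K)%N.
  rewrite ltnS; apply: le_truncn; rewrite ler_pM2r ?invr_gt0//.
  by have := fM x; rewrite ler_norml => /andP[]; lra.
exists K, (fun k => t @^-1` `[k%:R, k.+1%:R[%classic), (fun k => k%:R * e - M).
have AE (k : 'I_K) x : (\1_(t @^-1` `[k%:R, k.+1%:R[%classic) x : R) =
    (Num.trunc (t x) == k :> nat)%:R.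
  rewrite indicE truncn_eq//; congr (nat_of_bool _ )%:R.
  by apply/idP/idP => [/set_mem|h]; rewrite /= ?in_itv//=; apply/mem_set; rewrite /= in_itv.
split.
- move=> k; rewrite -[X in measurable X]setTI.
  have mt : measurable_fun [set: T] t.
    by apply: measurable_funM => //; apply: measurable_funD.
  by apply: mt => //; exact: measurable_itv.
- move=> x; rewrite (eq_bigr _ (fun k _ => AE k x)).
  rewrite (bigD1 (Ordinal (tK x)))//= eqxx big1 ?addr0// => k kx.
  case: eqP => // kE.
  by move: kx; rewrite -val_eqE/= kE eqxx.
- move=> k x /=; rewrite in_itv/= /t ler_pdivlMr// ltr_pdivrMr//.
  by rewrite -addn1 natrD => /andP[h1 h2]; rewrite ler_norml; apply/andP; split; nra.
Qed.

(** A step function approximates [f] within [e / 3] uniformly, hence for all the measures at once,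
    and its integrals converge by assumption. *)
Lemma bmfun_cvg_setwise d (T : measurableType d) (R : realType)
    (nu_ : nat -> probability T R) (nu : probability T R) (U : set_system nat)
    (f : T -> R) : Filter U ->
  (forall A, measurable A -> \int[nu_ n]_x \1_A x @[n --> U] --> \int[nu]_x \1_A x) ->
  bounded_measurable f ->
  \int[nu_ n]_x f x @[n --> U] --> \int[nu]_x f x.
Proof.
move=> FU nuA bf; apply/cvgrPdist_le => e e0.
have e3 : 0 < e / 3 by rewrite divr_gt0.
have [K [A [a [mA A1 Aa]]]] := bmfun_step bf e3.
have step (mu : probability T R) :
    `|\sum_k (\int[mu]_x \1_(A k) x) * a k - \int[mu]_x f x| <= e / 3.
  apply: Rintegral_weights_dist_le => //.
    by move=> k; exact: bmfun_indic.
  move=> k x; rewrite indicE; have [xA _|] := boolP (x \in A k); last by rewrite ltxx.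
  by apply: Aa; exact: set_mem.
have sumcvg : \sum_k (\int[nu_ n]_x \1_(A k) x) * a k @[n --> U] -->
    \sum_k (\int[nu]_x \1_(A k) x) * a k.
  by apply: cvgr_sum => k; apply: cvgMl; exact: nuA.
near=> n.
have h : `|\sum_k (\int[nu]_x \1_(A k) x) * a k - \sum_k (\int[nu_ n]_x \1_(A k) x) * a k| <= e / 3.
  by near: n; exact: (cvgr_dist_le _ _ sumcvg _ e3).
have h1 := step nu; have h2 := step (nu_ n).
by move: h h1 h2; rewrite !ler_norml; lra.
Unshelve. all: by end_near. Qed.

(** * Measured Gromov-Hausdorff convergence *)

Section probability_of_measure.
Context d (T : measurableType d) (R : realType) (m : {measure set T -> \bar R}).
Hypothesis m1 : m [set: T] = 1%E.

(** An alias of [m] that carries the proof of unit mass as an argument, so that a probability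
    structure can be attached to it. *)
Definition unit_mass_measure of m [set: T] = 1%E : set T -> \bar R := m.

HB.instance Definition _ := Measure.copy (unit_mass_measure m1) m.

HB.instance Definition _ :=
  @Measure_isProbability.Build _ _ R (unit_mass_measure m1) m1.

Lemma measure_is_probability : exists P : probability T R, (P : set T -> \bar R) = m.
Proof. by exists (unit_mass_measure m1). Qed.

End probability_of_measure.

Section bcd_lemmas.
Context (R : realType) (X : pmetricType R).
Hypothesis cX : compact [set: X].
Implicit Types (nu : probability (borel X) R).

Lemma P2T nu : P2 nu.
Proof.
exists point; have [D D0 XD] := compact_mdist_bounded cX.
have bm : bounded_measurable (fun x : borel X => @mdist R X point x ^+ 2).
  apply: (bmfun_comp (h := fun x : borel X => (point : borel X, x)) _ (bmfun_mdist2 cX)).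
  exact: pair1_measurable.
by rewrite integral_EFin_Rintegral ?ltry//; exact: bmfun_integrable.
Qed.

Lemma DEntP (m nu : probability (borel X) R) (C : R) :
  entropy_dual m nu C -> DEnt m nu.
Proof.
move=> H; split; first exact: P2T.
have := dual_Ent_le H; case E: (Ent m nu) => [r| |]//= _.
(* The value [-oo] is excluded by the dual bound with [C = -2] at [f = 0], which would read
   [0 <= - 2 + exp (- 1)]. *)
have /Ent_le_dual : (Ent m nu <= (- 2)%:E)%E by rewrite E leNye.
move=> /(_ _ (bmfun_cst _ 0)); rewrite !Rintegral_cstT sub0r.
have : expR (- 1) <= 1 :> R by rewrite -[leRHS]expR0 ler_expR oppr_le0.
lra.
Qed.

Lemma bar_costE k (lambda : 'I_k -> R) (mu : 'I_k -> probability (borel X) R) nu :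
  bar_cost lambda mu nu = (\sum_s lambda s * W2sq nu (mu s))%:E.
Proof.
rewrite /bar_cost -sumEFin; apply: eq_bigr => s _.
by rewrite W2_sqr.
Qed.

End bcd_lemmas.

Section mGH.
Context (R : realType) (X_ : nat -> pmetricType R)
  (m_ : forall j, probability (borel (X_ j)) R) (X Z : pmetricType R)
  (i_ : forall j, X_ j -> Z) (i : X -> Z).
Arguments i_ : clear implicits.
Hypotheses (iso_ : forall j, isometric_embedding (i_ j)) (iso : isometric_embedding i).
Arguments iso_ : clear implicits.

Let measurable_emb (Y : pmetricType R) (h : Y -> Z) : isometric_embedding h ->
  measurable_fun [set: borel Y] (h : borel Y -> borel Z).
Proof. by move=> isoh; apply: continuous_measurable_borel; exact: isometric_continuous. Qed.

Let integral_emb (Y : pmetricType R) (h : Y -> Z) (m : {measure set (borel Y) -> \bar R})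
    (f : Z -> R) : isometric_embedding h -> continuous f -> (forall z, 0 <= f z) ->
  (\int[pushforward m (h : borel Y -> borel Z)]_(z in [set: borel Z]) (f z)%:E
   = \int[m]_x (f (h x))%:E)%E.
Proof.
move=> isoh cf f0; rewrite ge0_integral_pushforward//.
- exact: measurable_emb.
- by apply/measurable_EFinP; exact: continuous_measurable_realfun.
- by move=> z _; rewrite lee_fin.
Qed.

(** Weak convergence is tested on the constant function 1. *)
Lemma weak_limit_setT (m : {measure set (borel X) -> \bar R}) :
  weakly_converges
    (fun j => pushforward (m_ j) (i_ j : borel (X_ j) -> borel Z))
    (pushforward m (i : borel X -> borel Z)) -> m [set: borel X] = 1%E.
Proof.
move=> H; have c1 : continuous (fun _ : Z => 1 : R) by move=> z; exact: cvg_cst.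
have b1 : bounded_fun (fun _ : Z => 1 : R).
  by exists 1; split => // M M1 z _ /=; rewrite normr1 ltW.
have {b1}H := H _ c1 b1.
rewrite integral_emb// in H.
have e j : (\int[pushforward (m_ j) (i_ j : borel (X_ j) -> borel Z)]_(z in
    [set: borel Z]) 1%:E)%E = 1%E :> \bar R.
  by rewrite integral_emb// integral_cst//= probability_setT mule1.
rewrite (eq_cvg _ _ e) integral_cst//= mul1e in H.
by apply: (@cvg_unique _ (@ereal_hausdorff R) _ _ _ _ H); exact: cvg_cst.
Qed.

Variable m : probability (borel X) R.
Hypotheses (cX : compact [set: X]) (m_full : full_support m)
  (haus : (fun j => hausdorff_dist (range (i_ j)) (range i)) @ \oo --> 0%E)
  (weak : weakly_converges
    (fun j => pushforward (m_ j) (i_ j : borel (X_ j) -> borel Z))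
    (pushforward m (i : borel X -> borel Z))).

Lemma bmfun_emb (Y : pmetricType R) (h : Y -> Z) (f : Z -> R) :
  isometric_embedding h -> continuous f -> (forall z, 0 <= f z <= 1) ->
  bounded_measurable (fun y : borel Y => f (h y)).
Proof.
move=> isoh cf f01.
apply: (@bmfun_continuous R Y (f \o h)) => y /=; last exact: f01.
by apply: continuous_comp; [exact: isometric_continuous|exact: cf].
Qed.

Lemma weak_cvg_Rintegral (f : Z -> R) : continuous f -> (forall z, 0 <= f z <= 1) ->
  \int[m_ j]_y f (i_ j y) @[j --> \oo] --> \int[m]_x f (i x).
Proof.
move=> cf f01; have f0 z : 0 <= f z by have /andP[] := f01 z.
have bf : bounded_fun f.
  exists 1; split => // M M1 z _ /=; rewrite ger0_norm// (le_trans _ (ltW M1))//.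
  by have /andP[] := f01 z.
have bi := bmfun_emb iso cf f01.
have H := weak cf bf.
have e0 := integral_emb m iso cf f0.
rewrite (integral_EFin_Rintegral (bmfun_integrable m bi)) in e0.
rewrite e0 in H.
have e j : (\int[pushforward (m_ j) (i_ j : borel (X_ j) -> borel Z)]_(z in
    [set: borel Z]) (f z)%:E)%E
    = (\int[m_ j]_y f (i_ j y))%:E.
  rewrite (integral_emb (m_ j) (iso_ j) cf f0).
  exact: integral_EFin_Rintegral (bmfun_integrable (m_ j) (bmfun_emb (iso_ j) cf f01)).
by rewrite (eq_cvg _ _ e) in H; exact: fine_cvg H.
Qed.

(** By continuity [f] exceeds half its value at [i x] on a neighbourhood of [x], which has positive
    mass. *)
Lemma full_support_Rintegral_gt0 (f : Z -> R) (x : X) : continuous f ->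
  (forall z, 0 <= f z <= 1) -> 0 < f (i x) -> 0 < \int[m]_x f (i x).
Proof.
move=> cf f01 fx; pose V : set X := [set y | f (i x) / 2 < f (i y)].
have oV : open V.
  rewrite (_ : V = (f \o i) @^-1` [set t | f (i x) / 2 < t])//.
  apply: open_comp; last exact: open_gt.
  by move=> y _; apply: continuous_comp; [exact: isometric_continuous|exact: cf].
have Vx : V x by rewrite /V/=; lra.
have mV : (0 < m V)%E.
  have sx : Defs.support m x by rewrite (m_full : Defs.support m = [set: X]).
  exact: (sx V oV Vx).
have mV' : measurable (V : set (borel X)) by exact: open_measurable_borel.
have bf := bmfun_emb iso cf f01.
have bV := bmfun_indic R mV'.
apply: (@lt_le_trans _ _ (f (i x) / 2 * \int[m]_y \1_V y)).
  rewrite Rintegral_indicT// mulr_gt0 ?divr_gt0//.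
  by rewrite fine_gt0// mV/= ltey_eq fin_num_measure.
rewrite -bmfun_RintegralZl//; apply: le_bmfun_Rintegral => //; first exact: bmfunZ.
move=> y; rewrite indicE; have [yV|_] := boolP (y \in V).
  by rewrite mulr1; move/set_mem : yV => /ltW.
by rewrite mulr0; have /andP[] := f01 (i y).
Qed.

Lemma hausdorff_near (r : R) : 0 < r ->
  \forall j \near \oo, forall y, exists x, mdist (i x) (i_ j y) < r.
Proof.
move=> r0; have : \forall j \near \oo, (hausdorff_dist (range (i_ j)) (range i) < r%:E)%E.
  have h0 : nbhs (0%E : \bar R) [set t | (t < r%:E)%E].
    by apply: open_nbhs_nbhs; split; [exact: open_ereal_lt_ereal|rewrite /= lte_fin].
  exact: (haus h0).
apply: filterS => j; rewrite /hausdorff_dist gt_max => /andP[+ _] y.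
move=> h; have : (ereal_inf [set (mdist (i_ j y) b)%:E | b in range i] < r%:E)%E.
  by apply: le_lt_trans h; apply: ereal_sup_ubound; exists (i_ j y) => //; exists y.
by move=> /ereal_inf_lt[_ [_ [x _ <-] <-]]; rewrite lte_fin metric_sym; exists x.
Qed.

(** The partition is built around the image of [X], with centres in it, so all cells have positive
    [m]-mass. It sums to 1 on the image of [X_ j] as soon as this lies in the [e / 4]-neighbourhood
    of the image of [X]. There are finitely many cells, so weak convergence controls all mass ratios
    by [exp e] for the same large [j]. *)
Lemma adapted_partition (e : R) : 0 < e ->
  exists (I : finType) (ctr : I -> Z) (phi : I -> Z -> R),
    [/\ forall l, continuous (phi l), forall l z, 0 <= phi l z <= 1,
        forall l z, 0 < phi l z -> mdist (ctr l) z < e,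
        (forall x, \sum_l phi l (i x) = 1) /\ (forall l, 0 < \int[m]_x phi l (i x)) &
        \forall j \near \oo, (forall y, \sum_l phi l (i_ j y) = 1) /\
          forall l, [/\ 0 < \int[m_ j]_y phi l (i_ j y),
            \int[m]_x phi l (i x) <= expR e * \int[m_ j]_y phi l (i_ j y) &
            \int[m_ j]_y phi l (i_ j y) <= expR e * \int[m]_x phi l (i x)]].
Proof.
move=> e0.
have crange : compact (range i).
  by apply: continuous_compact => //; apply: continuous_subspaceT; exact: isometric_continuous.
have [I [ctr [phi [phic phi01 phid phictr phi1]]]] := partition_of_unity crange e0.
have e4 : 0 < e / 4 by rewrite divr_gt0.
have phi_gt0 l : 0 < \int[m]_x phi l (i x).
  have [[x _ xl] phil] := phictr l.
  by apply: (@full_support_Rintegral_gt0 _ x) => //; rewrite xl.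
exists I, ctr, phi; split => //.
  by split => // x; apply: (phi1 (i x)); [exists x|rewrite mdistxx].
near=> j; split.
  move=> y; have : exists x, mdist (i x) (i_ j y) < e / 4.
    by move: y; near: j; exact: hausdorff_near.
  by move=> [x xy]; apply: (phi1 (i x)) => //; exists x.
near: j; apply: filter_forall => l.
have := weak_cvg_Rintegral (phic l) (phi01 l).
set a := \int[m]_x _ => acvg; have a0 : 0 < a := phi_gt0 l.
have ea : a * expR (- e) < a.
  by rewrite gtr_pMr// -[ltRHS]expR0 ltr_expR oppr_lt0.
have ea' : a < expR e * a by rewrite ltr_pMl// -[ltLHS]expR0 ltr_expR.
near=> j.
have h1 : a * expR (- e) < \int[m_ j]_y phi l (i_ j y).
  by near: j; exact: (cvgr_gt _ acvg).
have h2 : \int[m_ j]_y phi l (i_ j y) < expR e * a.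
  by near: j; exact: (cvgr_lt _ acvg).
split; [|by rewrite mulrC -ler_pdivrMr ?expR_gt0// -expRN ltW|exact: ltW].
by apply: lt_trans h1; rewrite mulr_gt0// expR_gt0.
Unshelve. all: by end_near. Qed.

End mGH.

Lemma limn_esup_near_lt (R : realType) (u : nat -> R) (a e : R) : 0 < e ->
  (limn_esup (fun j => (u j)%:E) <= a%:E)%E -> \forall j \near \oo, u j < a + e.
Proof.
move=> e0; rewrite limn_esup_lim (cvg_lim _ (@cvg_esups_inf _ _))// => h.
have /ereal_inf_lt[_ [n _ <-] lt] : (ereal_inf (range (esups (fun j => (u j)%:E)))
    < (a + e)%:E)%E by rewrite (le_lt_trans h)// lte_fin ltrDl.
exists n => // j /= nj; rewrite -lte_fin; apply: le_lt_trans lt.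
by apply: ereal_sup_ubound; exists j.
Qed.

(** * Approximate barycentres at a fixed scale *)

Section one_scale.
Context (R : realType) (X_ : nat -> pmetricType R)
  (m_ : forall j, probability (borel (X_ j)) R) (X Z : pmetricType R)
  (m : probability (borel X) R)
  (i_ : forall j, X_ j -> Z) (i : X -> Z) (K_ delta_ : nat -> R) (K delta D : R).
Arguments i_ : clear implicits.
Hypotheses (iso_ : forall j, isometric_embedding (i_ j)) (iso : isometric_embedding i).
Arguments iso_ : clear implicits.
Hypotheses (cX_ : forall j, compact [set: X_ j]) (cX : compact [set: X])
  (ZD : forall x y : Z, mdist x y <= D) (m_full : full_support m)
  (haus : (fun j => hausdorff_dist (range (i_ j)) (range i)) @ \oo --> 0%E)
  (weak : weakly_converges
    (fun j => pushforward (m_ j) (i_ j : borel (X_ j) -> borel Z))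
    (pushforward m (i : borel X -> borel Z)))
  (K_cvg : K_ j @[j --> \oo] --> K)
  (limsup_delta : (limn_esup (fun j => (delta_ j)%:E) <= delta%:E)%E)
  (X_j_BCD : forall j, BCD (m_ j) (delta_ j) (K_ j)).
Arguments cX_ : clear implicits.

Variables (k : nat) (lambda : 'I_k -> R) (mu : 'I_k -> probability (borel X) R)
  (ent : 'I_k -> R).
Hypotheses (lambda_gt0 : forall s, 0 < lambda s) (lambda_sum : \sum_s lambda s = 1)
  (mu_ent : forall s, entropy_dual m (mu s) (ent s)).

Let D_ge0 : 0 <= D.
Proof. exact: le_trans (mdist_ge0 _ _) (ZD point point). Qed.

(* [nu] is the image on [X] of a barycentre [nu'] on some [X_ j], [w s] is the
   squared distance between [nu'] and the approximation on [X_ j] of [mu s], and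
   the matrices [c] discretize almost optimal couplings between them. *)
Lemma barycenter_one_scale (e : R) : 0 < e ->
  exists nu : probability (borel X) R, exists w : 'I_k -> R,
  [/\ forall s, 0 <= w s <= D ^+ 2,
      entropy_dual m nu (\sum_s lambda s * ent s - K / 2 * \sum_s lambda s * w s
        + delta + (3 + D ^+ 2) * e),
      forall sigma : probability (borel X) R,
        \sum_s lambda s * w s <=
        \sum_s lambda s * W2sq sigma (mu s) + 8 * (D * e) &
      forall s (I : finType) (ctr : I -> Z) (phi : I -> Z -> R) (r : R),
        (forall l, continuous (phi l)) -> (forall l z, 0 <= phi l z <= 1) ->
        (forall l z, 0 < phi l z -> mdist (ctr l) z < r) ->
        (forall z, \sum_l phi l z = 1) ->
        exists c : I * I -> R,
        [/\ (forall p, 0 <= c p), \sum_p c p = 1,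
            \sum_p c p * mdist (ctr p.1) (ctr p.2) ^+ 2 <= w s + e + 4 * (D * r),
            forall l (a : R), (forall y z, mdist y z < e -> `|phi l y - phi l z| <= a) ->
              `|\sum_l' c (l, l') - \int[nu]_x phi l (i x)| <= 2 * a &
            forall l' (a : R), (forall y z, mdist y z < e -> `|phi l' y - phi l' z| <= a) ->
              `|\sum_l c (l, l') - \int[mu s]_x phi l' (i x)| <= 2 * a]].
Proof.
move=> e0.
have [I [ctr [phi [phic phi01 phid [phi1 phi_gt0] near_part]]]] :=
  adapted_partition iso_ iso cX m_full haus weak e0.
have near_K : \forall j \near \oo, `|K - K_ j| <= e by exact: (cvgr_dist_le _ _ K_cvg _ e0).
have near_d := limn_esup_near_lt e0 limsup_delta.
have [j [[phi1' part] Kj dj]] : exists j, [/\ (forall y, \sum_l phi l (i_ j y) = 1) /\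
    forall l, [/\ 0 < \int[m_ j]_y phi l (i_ j y),
            \int[m]_x phi l (i x) <= expR e * \int[m_ j]_y phi l (i_ j y) &
            \int[m_ j]_y phi l (i_ j y) <= expR e * \int[m]_x phi l (i x)],
    `|K - K_ j| <= e & delta_ j < delta + e].
  near \oo => j; exists j; split; near: j.
  - exact: near_part.
  - exact: near_K.
  - exact: near_d.
have phi_ge0 l z : 0 <= phi l z by have /andP[] := phi01 l z.
pose psi l (x : borel X) := phi l (i x).
pose psi' l (y : borel (X_ j)) := phi l (i_ j y).
have bpsi l : bounded_measurable (psi l) by exact: bmfun_emb.
have bpsi' l : bounded_measurable (psi' l) by exact: (bmfun_emb (iso_ j)).
have psi0 l x : 0 <= psi l x by exact: phi_ge0.
have psi0' l y : 0 <= psi' l y by exact: phi_ge0.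
have psi'_gt0 l : 0 < \int[m_ j]_y psi' l y by have [] := part l.
have transfer_to sigma := exists_transfer bpsi bpsi' psi0 psi0' phi1 psi'_gt0 sigma.
have transfer_from sigma := exists_transfer bpsi' bpsi psi0' psi0 phi1' phi_gt0 sigma.
have /choice[mu' mu'P] s := transfer_to (mu s).
have mu'_ent s : entropy_dual (m_ j) (mu' s) (ent s + e).
  apply: (transfer_entropy_dual bpsi bpsi' psi0 psi0' phi1 phi1' psi'_gt0 (mu'P s) _ (mu_ent s)).
  by move=> l; have [] := part l.
have [nu' [_ nu'_bar] nu'_ent] := X_j_BCD lambda_gt0 lambda_sum
  (fun s => DEntP (cX_ j) (mu'_ent s)).
pose w s := W2sq nu' (mu' s).
pose V := \sum_s lambda s * w s.
have VE : Var lambda mu' = V%:E by rewrite -nu'_bar bar_costE//; exact: cX_.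
have diamj (x y : X_ j) : mdist x y <= D by rewrite -(iso_ j).
have w_bound s : 0 <= w s <= D ^+ 2.
  by rewrite W2sq_ge0 ?W2sq_le_diam//; exact: cX_.
have V_bound : 0 <= V <= D ^+ 2.
  apply/andP; split.
    apply: sumr_ge0 => s _; rewrite mulr_ge0 ?(ltW (lambda_gt0 _))//.
    by have /andP[] := w_bound s.
  rewrite -[leRHS]mul1r -lambda_sum mulr_suml; apply: ler_sum => s _.
  by rewrite ler_wpM2l ?(ltW (lambda_gt0 _))//; have /andP[] := w_bound s.
have ent_nu' : entropy_dual (m_ j) nu'
    (\sum_s lambda s * ent s + e - K_ j / 2 * V + delta_ j).
  apply: Ent_le_dual; apply: (le_trans nu'_ent); rewrite VE.
  rewrite EFinD leeD2r// EFinB -EFinM leeB//.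
  have -> : \sum_s lambda s * ent s + e = \sum_s lambda s * (ent s + e).
    by under [RHS]eq_bigr do rewrite mulrDr; rewrite big_split/= -mulr_suml lambda_sum mul1r.
  rewrite -sumEFin; apply: lee_sum => s _; rewrite EFinM.
  by rewrite lee_wpmul2l ?lee_fin ?(ltW (lambda_gt0 _))//; exact: dual_Ent_le.
have [nu nuP] := transfer_from nu'.
exists nu, w; split => //.
(* The error has one [e] from sending the atoms to [X_ j], one from [delta_ j], one from sending the
   barycentre back, and at most [e * D ^+ 2] from replacing [K_ j] by [K]. *)
- have := transfer_entropy_dual bpsi' bpsi psi0' psi0 phi1' phi1 phi_gt0 nuP
    (fun l => let: And3 _ _ h := part l in h) ent_nu'.
  rewrite -/V => H f bf; apply: (le_trans (H f bf)); rewrite lerD2r.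
  have : (K - K_ j) * V <= e * D ^+ 2.
    move/andP: V_bound => [V0 V1]; rewrite (le_trans (ler_norm _))// normrM (ger0_norm V0).
    exact: ler_pM.
  have : 0 <= e * D ^+ 2 by rewrite mulr_ge0 ?sqr_ge0// ltW.
  lra.
(* The image of [sigma] on [X_ j] competes with the barycentre [nu']. *)
- move=> sigma; have [sigma' sigma'P] := transfer_to sigma.
  have : (V%:E <= bar_cost lambda mu' sigma')%E.
    by rewrite -VE; apply: ereal_inf_lbound; exists sigma' => //; exact: P2T (cX_ j) _.
  rewrite bar_costE; last exact: cX_.
  rewrite lee_fin => /le_trans; apply.
  set c8 := 8 * (D * e); rewrite -[X in _ <= _ + X]mul1r -lambda_sum mulr_suml -big_split/=.
  apply: ler_sum => s _; rewrite -mulrDr ler_wpM2l ?(ltW (lambda_gt0 _))//.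
  exact: (W2sq_transfer_le ZD phic phi01 phid cX (cX_ j) iso (iso_ j) phi1 psi'_gt0
    sigma'P (mu'P s)).
move=> s J ctr2 chi r chic chi01 chid chi1.
have [q qc qlt] := W2sq_lt (cX_ j) nu' (mu' s) e0.
have chi1' y : \sum_l chi l (i_ j y) = 1 by exact: chi1.
exists (coupling_matrix chi (i_ j) q); split.
- by move=> p; apply: coupling_matrix_ge0 => //.
- exact: (coupling_matrix_sum chic chi01 (iso_ j) chi1' q).
- have := coupling_matrix_cost ZD chic chi01 chid (cX_ j) (iso_ j) chi1' q.
  by rewrite /w; lra.
(* The coupling lives on [X_ j] while the marginals are wanted on [X]: the transfer moves mass only
   within cells of [phi], so [chi l] is compared with its value at their centres. *)
- move=> l a chia; rewrite (coupling_matrix_suml chic chi01 (iso_ j) chi1' l qc) distrC.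
  apply: (transfer_Rintegral_dist_le bpsi' bpsi psi0' psi0 phi1' phi_gt0 nuP
    (F := fun l' => chi l (ctr l'))).
  + exact: (bmfun_emb (iso_ j)).
  + exact: bmfun_emb.
  + by move=> l' x /phid/chia.
  + by move=> l' x /phid/chia.
- move=> l a chia; rewrite (coupling_matrix_sumr chic chi01 (iso_ j) chi1' l qc).
  apply: (transfer_Rintegral_dist_le bpsi bpsi' psi0 psi0' phi1 psi'_gt0 (mu'P s)
    (F := fun l' => chi l (ctr l'))).
  + exact: bmfun_emb.
  + exact: (bmfun_emb (iso_ j)).
  + by move=> l' x /phid/chia.
  + by move=> l' x /phid/chia.
Unshelve. all: by end_near. Qed.

End one_scale.

(** * Limit of the scales *)

Section stability.
Context (R : realType) (X_ : nat -> pmetricType R)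
  (m_ : forall j, probability (borel (X_ j)) R) (X Z : pmetricType R)
  (m : probability (borel X) R)
  (i_ : forall j, X_ j -> Z) (i : X -> Z) (K_ delta_ : nat -> R) (K delta : R).
Arguments i_ : clear implicits.
Hypotheses (iso_ : forall j, isometric_embedding (i_ j)) (iso : isometric_embedding i).
Arguments iso_ : clear implicits.
Hypotheses (cX_ : forall j, compact [set: X_ j]) (cX : compact [set: X])
  (cZ : compact [set: Z]) (m_full : full_support m)
  (haus : (fun j => hausdorff_dist (range (i_ j)) (range i)) @ \oo --> 0%E)
  (weak : weakly_converges
    (fun j => pushforward (m_ j) (i_ j : borel (X_ j) -> borel Z))
    (pushforward m (i : borel X -> borel Z)))
  (K_cvg : K_ j @[j --> \oo] --> K)
  (limsup_delta : (limn_esup (fun j => (delta_ j)%:E) <= delta%:E)%E)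
  (X_j_BCD : forall j, BCD (m_ j) (delta_ j) (K_ j)).
Arguments cX_ : clear implicits.

Lemma BCD_stable : BCD m delta K.
Proof.
move=> k lambda mu lambda_gt0 lambda_sum mu_DEnt.
have [D D0 ZD] := compact_mdist_bounded cZ.
pose ent s := fine (Ent m (mu s)).
have entE s : Ent m (mu s) = (ent s)%:E by rewrite /ent fineK//; case: (mu_DEnt s).
have mu_ent s : entropy_dual m (mu s) (ent s) by apply: Ent_le_dual; rewrite entE.
pose eps n : R := n.+1%:R^-1.
have eps_gt0 n : 0 < eps n by rewrite invr_gt0.
have [nu /choice[w wP]] := choice (fun n => barycenter_one_scale iso_ iso cX_ cX ZD m_full haus
    weak K_cvg limsup_delta X_j_BCD lambda_gt0 lambda_sum mu_ent (eps_gt0 n)).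
(* One ultrafilter makes the distances, the measures and the matrices converge simultaneously, with
   no extraction of subsequences. *)
have [U UU Uoo] := exists_ultrafilter_infty.
have eps_oo : eps n @[n --> \oo] --> (0 : R) by exact: cvg_harmonic.
have epsU : eps n @[n --> U] --> (0 : R) by move=> V hV; exact/Uoo/eps_oo.
have wD n s : 0 <= w n s <= D ^+ 2 by have [] := wP n.
have /choice[wlim wlimP] s : exists l : R, w n s @[n --> U] --> l.
  apply: (@ultrafilter_bounded_cvg R U (w^~ s) (D ^+ 2)) => n.
  by have /andP[w0 wD2] := wD n s; rewrite ger0_norm.
pose V := \sum_s lambda s * wlim s.
have Vcvg : \sum_s lambda s * w n s @[n --> U] --> V.
  by apply: cvgr_sum => s; apply: cvgMr; exact: wlimP.
pose C n := \sum_s lambda s * ent s - K / 2 * \sum_s lambda s * w n s + delta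
  + (3 + D ^+ 2) * eps n.
pose Clim := \sum_s lambda s * ent s - K / 2 * V + delta.
have Ccvg : C n @[n --> U] --> Clim.
  rewrite -[Clim]addr0 -(mulr0 (3 + D ^+ 2)).
  apply: cvgD; last exact: cvgMr.
  apply: cvgD; last exact: cvg_cst.
  apply: cvgB; first exact: cvg_cst.
  exact: cvgMr.
(* A bound independent of [n] and valid for either sign of [K]; the countable additivity of the
   setwise limit rests on it. *)
pose Cmax := \sum_s lambda s * ent s + `|K / 2| * D ^+ 2 + delta + (3 + D ^+ 2).
have nu_dual n : entropy_dual m (nu n) Cmax.
  have [_ + _ _] := wP n => H f bf; apply: (le_trans (H f bf)); rewrite lerD2r.
  have D2 : 0 <= D ^+ 2 by exact: sqr_ge0.
  have eps1 : eps n <= 1 by rewrite invf_le1// ler1n.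
  have h1 : (3 + D ^+ 2) * eps n <= 3 + D ^+ 2 by rewrite ler_piMr// addr_ge0.
  have Vn0 : 0 <= \sum_s lambda s * w n s.
    by apply: sumr_ge0 => s _; rewrite mulr_ge0 ?(ltW (lambda_gt0 _))//; have /andP[] := wD n s.
  have VnD : \sum_s lambda s * w n s <= D ^+ 2.
    rewrite -[leRHS]mul1r -lambda_sum mulr_suml; apply: ler_sum => s _.
    by rewrite ler_wpM2l ?(ltW (lambda_gt0 _))//; have /andP[] := wD n s.
  have h2 : - (K / 2 * \sum_s lambda s * w n s) <= `|K / 2| * D ^+ 2.
    rewrite (le_trans (ler_norm _))// normrN normrM (ger0_norm Vn0).
    by rewrite ler_wpM2l.
  by rewrite /Cmax; lra.
have [mu0 mu0P] := exists_setwise_limit UU nu_dual.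
have mu0_cvg f : bounded_measurable f -> \int[nu n]_x f x @[n --> U] --> \int[mu0]_x f x.
  exact: bmfun_cvg_setwise mu0P.
have mu0_ent : entropy_dual m mu0 Clim.
  move=> f bf; rewrite -lerBlDl.
  have h : \int[nu n]_x f x - C n @[n --> U] --> \int[mu0]_x f x - Clim.
    by apply: cvgB => //; exact: mu0_cvg.
  by apply: (cvgr_to_le h); apply: nearW => n; rewrite lerBlDl; have [_ + _ _] := wP n; apply.
have W_le s : W2sq mu0 (mu s) <= wlim s.
  (* With this [r] the error [4 * (D * r)] is [e / 2]. It is paid twice, for discretizing the
     couplings and for returning from the limit matrix. *)
  apply/ler_addgt0Pr => e e0; pose r := e / (8 * D).
  have r0 : 0 < r by rewrite divr_gt0// mulr_gt0.
  have [I [ctr [phi [phic phi01 phid _ phi1]]]] := partition_of_unity cZ r0.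
  have {}phi1 z : \sum_l phi l z = 1.
    by apply: (phi1 z) => //; rewrite mdistxx divr_gt0.
  have [c cP] := choice (fun n =>
    let: And4 _ _ _ H := wP n in H s I ctr phi r phic phi01 phid phi1).
  have c0 n p : 0 <= c n p by have [] := cP n.
  have c1 n : \sum_p c n p = 1 by have [] := cP n.
  have /choice[clim climP] p : exists l : R, c n p @[n --> U] --> l.
    apply: (@ultrafilter_bounded_cvg R U (c^~ p) 1) => n.
    by rewrite ger0_norm// -(c1 n) (bigD1 p)//= lerDl sumr_ge0.
  (* The marginals of the [n]-th matrix are wrong by at most twice the oscillation of [h] at scale
     [eps n], which tends to 0 by uniform continuity; the limit matrix therefore has exact
     marginals. *)
  have marginal (d : nat -> R) (a : R) (h : Z -> R) (rho_ : nat -> probability (borel X) R)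
      (rho : probability (borel X) R) :
      continuous h ->
      (\int[rho_ n]_x h (i x) @[n --> U] --> \int[rho]_x h (i x)) ->
      (forall n (b : R), (forall y z, mdist y z < eps n -> `|h y - h z| <= b) ->
        `|d n - \int[rho_ n]_x h (i x)| <= 2 * b) ->
      d n @[n --> U] --> a -> a = \int[rho]_x h (i x).
    move=> hc hcvg dP da; apply: (@cvg_unique _ (@Rhausdorff R) _ _ _ _ da).
    apply/cvgrPdist_le => b b0; have b4 : 0 < b / 4 by rewrite divr_gt0.
    have b2 : 0 < b / 2 by rewrite divr_gt0.
    have [r1 r10 hr1] := compact_unif_continuous cZ hc b4.
    near=> n.
    have h1 : `|\int[rho]_x h (i x) - \int[rho_ n]_x h (i x)| <= b / 2.
      by near: n; exact: (cvgr_dist_le _ _ hcvg _ b2).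
    have h2 : eps n < r1 by near: n; exact: (cvgr_lt _ epsU).
    have := dP n (b / 4) (fun y z yz => hr1 y z (lt_trans yz h2)).
    by move: h1; rewrite !ler_norml; lra.
  have cl l : \sum_l' clim (l, l') = \int[mu0]_x phi l (i x).
    apply: (marginal (fun n => \sum_l' c n (l, l')) _ _ nu mu0 (phic l)).
    - by apply: mu0_cvg; exact: bmfun_emb.
    - by move=> n b hb; have [_ _ _ + _] := cP n; apply.
    - by apply: cvgr_sum => l'; exact: climP.
  have cr l' : \sum_l clim (l, l') = \int[mu s]_x phi l' (i x).
    apply: (marginal (fun n => \sum_l c n (l, l')) _ _ (fun=> mu s) (mu s) (phic l')).
    - exact: cvg_cst.
    - by move=> n b hb; have [_ _ _ _ +] := cP n; apply.
    - by apply: cvgr_sum => l; exact: climP.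
  have clim0 p : 0 <= clim p.
    by apply: (cvgr_to_ge (climP p)); exact: nearW.
  have clim1 : \sum_p clim p = 1.
    have h : \sum_p c n p @[n --> U] --> \sum_p clim p by exact: cvgr_sum.
    rewrite (eq_cvg _ _ c1) in h.
    by apply: (@cvg_unique _ (@Rhausdorff R) _ _ _ _ h); exact: cvg_cst.
  have := W2sq_le_matrix ZD phic phi01 phid cX iso (fun x => phi1 (i x)) clim0 clim1 cl cr.
  move/le_trans; apply.
  have Ds : 4 * (D * r) = e / 2 by rewrite /r; field; exact: lt0r_neq0.
  rewrite Ds.
  have h : \sum_p c n p * mdist (ctr p.1) (ctr p.2) ^+ 2 - w n s - eps n @[n --> U] -->
      \sum_p clim p * mdist (ctr p.1) (ctr p.2) ^+ 2 - wlim s - 0.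
    apply: cvgB => //; apply: cvgB => //.
    by apply: cvgr_sum => p; apply: cvgMl; exact: climP.
  have : \sum_p clim p * mdist (ctr p.1) (ctr p.2) ^+ 2 - wlim s - 0 <= e / 2.
    apply: (cvgr_to_le h); apply: nearW => n.
    by have [_ _ + _ _] := cP n; rewrite Ds; lra.
  lra.
have V_le sigma : V <= \sum_s lambda s * W2sq sigma (mu s).
  have h : \sum_s lambda s * w n s - 8 * (D * eps n) @[n --> U] --> V - 8 * (D * 0).
    by apply: cvgB => //; apply: cvgMr; exact: cvgMr.
  have : V - 8 * (D * 0) <= \sum_s lambda s * W2sq sigma (mu s).
    by apply: (cvgr_to_le h); apply: nearW => n; rewrite lerBlDr; have [_ _ + _] := wP n; apply.
  by rewrite !mulr0 subr0.
(* Semicontinuity bounds the cost of [mu0] by [V], and [V] is at most the cost of any competitor, so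
   [mu0] is a barycentre. The variance is exactly [V], as the term in [K] demands when [K] has
   arbitrary sign. *)
have VE : \sum_s lambda s * W2sq mu0 (mu s) = V.
  apply/eqP; rewrite eq_le V_le andbT; apply: ler_sum => s _.
  by rewrite ler_wpM2l ?(ltW (lambda_gt0 _)).
have VarE : Var lambda mu = V%:E.
  apply/eqP; rewrite eq_le; apply/andP; split.
    apply: ge_ereal_inf; exists (bar_cost lambda mu mu0); last by rewrite bar_costE// VE.
    by exists mu0 => //; exact: P2T.
  apply: le_ereal_inf_tmp => _ [sigma _ <-].
  by rewrite bar_costE// lee_fin.
exists mu0.
  by split; [exact: P2T|rewrite bar_costE// VE VarE].
apply: (le_trans (dual_Ent_le mu0_ent)).
rewrite VarE (eq_bigr (fun s => (lambda s * ent s)%:E)); last first.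
  by move=> s _; rewrite entE EFinM.
by rewrite sumEFin -EFinM -EFinB -EFinD.
Unshelve. all: by end_near. Qed.

End stability.

Theorem theorem2p8 (R : realType)
    (X_ : nat -> pmetricType R)
    (m_ : forall j, probability (borel (X_ j)) R)
    (X : pmetricType R) (m : {measure set (borel X) -> \bar R})
    (K_ delta_ : nat -> R) (K delta : R)
    (X_j_compact : forall j, compact [set: X_ j])
    (X_j_geodesic : forall j, geodesic_space (X_ j))
    (m_j_full : forall j, full_support (m_ j))
    (X_compact : compact [set: X])
    (m_full : full_support m)
    (X_cvg : mGH_converges m_ m)
    (K_cvg : K_ j @[j --> \oo] --> K)
    (delta_ge0 : forall j, 0 <= delta_ j)
    (delta0 : 0 <= delta)
    (limsup_delta : (limn_esup (fun j => (delta_ j)%:E) <= delta%:E)%E)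
    (X_j_BCD : forall j, BCD (m_ j) (delta_ j) (K_ j)) :
  BCD m delta K.
Proof.
have [Z [i_ [i [cZ [iso_ iso] haus weak]]]] := X_cvg.
(* The limit [m] is given only as a measure; its unit mass lets it be replaced by a probability
   [P]. *)
have m1 : m [set: borel X] = 1%E := weak_limit_setT iso_ iso weak.
have [P Pm] := measure_is_probability m1.
have {}Pm := eq_measure Pm.
move: m_full weak; rewrite -Pm => P_full weak.
exact: (BCD_stable iso_ iso X_j_compact X_compact cZ P_full haus weak K_cvg
  limsup_delta X_j_BCD).
Qed.
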